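(* Let $\Bbbk$ be an algebraically closed field with $\operatorname{char}(\Bbbk)\neq 2$. Let $A$ be a graded skew Clifford algebra over $\Bbbk$, with degree-one generators $x_1,\ldots,x_n$ and degree-two generators $y_1,\ldots,y_n$, that is regular (i.e., $A$ is quadratic, Auslander-regular of global dimension $n$, and satisfies the Cohen-Macaulay property with Hilbert series $1/(1-t)^n$), and let $R$ be the subalgebra of $A$ generated by $y_1,\ldots,y_n$. Suppose that $A$ is a twist of a graded Clifford algebra $B$, with degree-one generators $X_1,\ldots,X_n$ and degree-two generators $Y_1,\ldots,Y_n$, by a graded automorphism $\tau\in\operatorname{Aut}(B)$ of degree zero, and let $C$ be the subalgebra of $B$ generated by $Y_1,\ldots,Y_n$. Then $R$ is a twist of $C$, and $R$ is a skew polynomial ring; that is, $R$ is a domain that has exactly $n(n-1)/2$ defining relations that guarantee that each $y_k$ is normal in $R$.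
   Context: Notation: $M(n,\Bbbk)$ is the space of $n\times n$ matrices over $\Bbbk$, and $M_{ij}$ is the $ij$'th entry of a matrix $M$. An element $u$ of a ring $E$ is normal in $E$ if $uE=Eu$. Graded Clifford algebra (GCA): given symmetric matrices $N_1,\ldots,N_n\in M(n,\Bbbk)$, the associated GCA is the $\Bbbk$-algebra $B$ on degree-one generators $X_1,\ldots,X_n$ and degree-two generators $Y_1,\ldots,Y_n$ with defining relations (a) $X_iX_j+X_jX_i=\sum_{k=1}^n (N_k)_{ij}Y_k$ for all $i,j=1,\ldots,n$, and (b) $Y_k$ is central for all $k=1,\ldots,n$. Graded skew Clifford algebra (GSCA): let $\mu\in M(n,\Bbbk)$ satisfy $\mu_{ij}\mu_{ji}=1$ for all $i\neq j$ and $\mu_{ii}=1$ for all $i$. A matrix $M\in M(n,\Bbbk)$ is called $\mu$-symmetric if $M_{ij}=\mu_{ij}M_{ji}$ for all $i,j$. Given $\mu$-symmetric matrices $M_1,\ldots,M_n\in M(n,\Bbbk)$, a GSCA is the $\Bbbk$-algebra $A$ on degree-one generators $x_1,\ldots,x_n$ and degree-two generators $y_1,\ldots,y_n$ with defining relations given by (a) the degree-two relations $x_ix_j+\mu_{ij}x_jx_i=\sum_{k=1}^n (M_k)_{ij}y_k$ for all $i,j=1,\ldots,n$, and (b) degree-three and degree-four relations that guarantee the existence of a normalizing sequence $\{y_1',\ldots,y_n'\}$ that spans $\sum_{k=1}^n\Bbbk y_k$ (normalizing sequence: $y_1'$ is normal in $A$ and, for each $k\geq 2$, the image of $y_k'$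 is normal in $A/\langle y_1',\ldots,y_{k-1}'\rangle$). Quadratic means generated by degree-one elements with defining relations of degree two. Auslander-regular of global dimension $n$ means noetherian, of global dimension $n$, and satisfying the Auslander condition: for every finitely generated module $M$, every $i\geq 0$ and every submodule $N\subseteq\operatorname{Ext}^i(M,A)$, one has $\operatorname{Ext}^j(N,A)=0$ for all $j<i$. The Cohen-Macaulay property means $\operatorname{GKdim}(M)+\min\{i:\operatorname{Ext}^i(M,A)\neq 0\}=\operatorname{GKdim}(A)$ for every nonzero finitely generated module $M$. Twist: let $D=\bigoplus_{k\geq 0}D_k$ be a graded $\Bbbk$-algebra and $\phi$ a graded degree-zero automorphism of $D$. The twist $D'$ of $D$ by $\phi$ is the graded $\Bbbk$-algebra that is the vector space $\bigoplus_{k\geq 0}D_k$ with new multiplication $*$ defined as follows: if $a'\in D'_i=D_i$ and $b'\in D'_j=D_j$, then $a'*b'=(a\,\phi^i(b))'$, where the right-hand side is computed using the original multiplication in $D$ and $a$ is the image of $a'$ in $D$, etc. A twist of $D$ means a twist of $D$ by some such automorphism.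
   Formalization: Added: the twist carries the span of the Y_k onto the span of the y_k. ''Each y_k is normal'' is stated for some basis of the span of the y_k, and for every basis of it normal in R. Literally false: take vu=quv with y=uv, u²+v², or y=u², u²+v². *)

(* Defs.v *)
From HB Require Import structures.
From mathcomp Require Import all_boot all_order all_algebra.
From mathcomp Require Import boolp reals ereal sequences exp Rstruct.

Set Implicit Arguments.
Unset Strict Implicit.
Unset Printing Implicit Defensive.

Import GRing.Theory.
Local Open Scope ring_scope.

(** * Homological notions over a ring [E]

    Left modules are [lmodType E]; right modules are left modules over the
    converse ring, [lmodType E^c].  Every two-sided notion below is stated for
    left modules and imposed on both [E] and [E^c]. *)

Section Homological.
Variable E : nzRingType.

Definition fin_gen (M : lmodType E) : Prop :=
  exists (m : nat) (g : 'I_m -> M),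
    forall u, exists c : 'I_m -> E, u = \sum_i c i *: g i.

Definition left_ideal (I : E -> Prop) : Prop :=
  [/\ I 0, forall a b, I a -> I b -> I (a + b) & forall e a, I a -> I (e * a)].

Definition left_noetherian : Prop :=
  forall I : E -> Prop, left_ideal I ->
  exists (m : nat) (g : 'I_m -> E),
    forall a, I a <-> exists c : 'I_m -> E, a = \sum_i c i * g i.

Definition projective (P : lmodType E) : Prop :=
  forall (U V : lmodType E) (g : {linear U -> V}) (f : {linear P -> V}),
    (forall v, exists u, g u = v) ->
    exists h : {linear P -> U}, forall p, g (h p) = f p.

Record proj_resolution (M : lmodType E) := ProjResolution {
  res_mod : nat -> lmodType E;
  res_diff : forall i, {linear res_mod i.+1 -> res_mod i};
  res_aug : {linear res_mod 0%N -> M};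
  res_proj : forall i, projective (res_mod i);
  res_aug_surj : forall u, exists p, res_aug p = u;
  res_exact0 : forall p, res_aug p = 0 <-> exists q, res_diff 0%N q = p;
  res_exactS : forall i p,
    res_diff i p = 0 <-> exists q, res_diff i.+1 q = p
}.

Definition proj_dim_le (m : nat) (M : lmodType E) : Prop :=
  exists P : proj_resolution M,
    forall i, (m < i)%N -> forall p : res_mod P i, p = 0.

Definition left_gldim (m : nat) : Prop :=
  (forall M : lmodType E, proj_dim_le m M) /\
  (forall l, (l < m)%N -> exists M : lmodType E, ~ proj_dim_le l M).

(* The complex Hom_E(P, E). *)
Definition ext_cocycle (M : lmodType E) (P : proj_resolution M) i
    (f : {linear res_mod P i -> E^o}) : Prop :=
  forall q, f (res_diff P i q) = 0.

Definition ext_coboundary (M : lmodType E) (P : proj_resolution M) i :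
    {linear res_mod P i -> E^o} -> Prop :=
  match i with
  | 0%N => fun f => forall p, f p = 0
  | j.+1 => fun f => exists g : {linear res_mod P j -> E^o},
      forall p, f p = g (res_diff P j p)
  end.

Definition Ext_zero (i : nat) (M : lmodType E) : Prop :=
  exists P : proj_resolution M,
    forall f : {linear res_mod P i -> E^o},
      ext_cocycle f -> ext_coboundary f.

(* [N] is (isomorphic to) the right [E]-module Ext^i_E(M, E): [phi] maps
   i-cocycles onto [N], with the i-coboundaries as kernel.  The right action on
   Hom_E(P_i, E) is (f a)(p) = f(p) a. *)
Definition is_Ext (i : nat) (M : lmodType E) (N : lmodType E^c) : Prop :=
  exists (P : proj_resolution M) (phi : {linear res_mod P i -> E^o} -> N),
  [/\ forall (f g h : {linear res_mod P i -> E^o}) (a : E),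
        ext_cocycle f -> ext_cocycle g ->
        (forall p, h p = (f p : E) * a + (g p : E)) ->
        phi h = (a : E^c) *: phi f + phi g,
      forall f, ext_cocycle f -> (phi f = 0 <-> ext_coboundary f)
    & forall u, exists2 f, ext_cocycle f & phi f = u].

End Homological.

(* Submodules of Ext^i(M, E) are given by injective linear maps. *)
Definition left_auslander_condition (E : nzRingType) : Prop :=
  forall (M : lmodType E) (i : nat) (N Q : lmodType E^c)
         (iota : {linear Q -> N}),
    fin_gen M -> is_Ext i M N -> injective iota ->
    forall j, (j < i)%N -> Ext_zero j Q.

Definition auslander_regular (E : nzRingType) (d : nat) : Prop :=
  [/\ left_noetherian E /\ left_noetherian E^c,
      left_gldim E d /\ left_gldim E^c d
    & left_auslander_condition E /\ left_auslander_condition E^c].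

(** * Dimension and Gelfand-Kirillov dimension *)

(* [act] is the action of the field, so that the definition also applies to
   modules over a [K]-algebra, which carry no declared [lmodType K] structure. *)
Definition has_dim (K : fieldType) (U : zmodType) (act : K -> U -> U)
    (P : U -> Prop) (d : nat) : Prop :=
  exists b : 'I_d -> U,
  [/\ forall i, P (b i),
      forall c : 'I_d -> K, \sum_i act (c i) (b i) = 0 -> forall i, c i = 0
    & forall u, P u -> exists c : 'I_d -> K, u = \sum_i act (c i) (b i)].

Definition lspan (K : fieldType) (U : lmodType K) m (b : 'I_m -> U) (u : U) :
    Prop :=
  exists c : 'I_m -> K, u = \sum_i c i *: b i.

Section GKdim.
Variables (K : fieldType) (E : nzRingType).
(* The structure map of the [K]-algebra [E]. *)
Variable sc : K -> E.

(* The subspace V^m M0, with V spanned by 1 and the [v i], and M0 spanned by the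
   [g j]. *)
Definition gk_filtration (r : nat) (v : 'I_r -> E) (M : lmodType E)
    (l : nat) (g : 'I_l -> M) (m : nat) (u : M) : Prop :=
  exists s : seq (K * seq 'I_r * 'I_l),
    all (fun t => (size t.1.2 <= m)%N) s /\
    u = \sum_(t <- s) (sc t.1.1 * \prod_(i <- t.1.2) v i) *: g t.2.

(* limsup of log dim(V^m M0) / log m, for generators [v] of the algebra [E] and
   [g] of the module [M]; the value does not depend on their choice. *)
Definition is_GKdim (M : lmodType E) (gk : \bar Rdefinitions.R) : Prop :=
  exists (r : nat) (v : 'I_r -> E) (l : nat) (g : 'I_l -> M) (d : nat -> nat),
  [/\ forall e, exists s : seq (K * seq 'I_r),
        e = \sum_(t <- s) sc t.1 * \prod_(i <- t.2) v i,
      forall u, exists c : 'I_l -> E, u = \sum_j c j *: g j,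
      forall m, has_dim (fun c u => sc c *: u) (gk_filtration v g m) (d m)
    & gk = limn_esup (fun m => (ln (d m)%:R / ln m%:R)%:E)].

Definition left_cohen_macaulay : Prop :=
  forall M : lmodType E, fin_gen M -> (exists u : M, u != 0) ->
  exists (j : nat) (gkM gkE : \bar Rdefinitions.R),
  [/\ is_GKdim M gkM, is_GKdim E^o gkE,
      ~ Ext_zero j M /\ (forall i, (i < j)%N -> Ext_zero i M)
    & (gkM + j%:R%:E)%E = gkE].

End GKdim.

Definition cohen_macaulay (K : fieldType) (A : algType K) : Prop :=
  left_cohen_macaulay (fun c : K => c%:A : A) /\
  left_cohen_macaulay (fun c : K => (c%:A : A) : A^c).

(** * Generators and relations *)

(* A noncommutative polynomial in variables indexed by [I], as a list of
   (coefficient, word) terms. *)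
Definition ncpoly (K : fieldType) (I : Type) := seq (K * seq I).

Definition nceval (K : fieldType) (I : Type) (A : algType K) (a : I -> A)
    (p : ncpoly K I) : A :=
  \sum_(t <- p) t.1 *: \prod_(i <- t.2) a i.

Definition nchomog (K : fieldType) (I : Type) (wt : I -> nat) (d : nat)
    (p : ncpoly K I) : bool :=
  all (fun t => (\sum_(i <- t.2) wt i == d)%N) p.

(* [A] is the [K]-algebra on generators [a] with defining relations
   [p = 0], [rel p]: the universal property. *)
Definition presented (K : fieldType) (I : Type) (A : algType K) (a : I -> A)
    (rel : ncpoly K I -> Prop) : Prop :=
  [/\ forall u, exists p, u = nceval a p,
      forall p, rel p -> nceval a p = 0
    & forall (D : algType K) (d : I -> D),
        (forall p, rel p -> nceval d p = 0) ->
        exists f : {lrmorphism A -> D}, forall i, f (a i) = d i].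

(* The degree-[d] part of the grading induced by generators [a i] of degree
   [wt i]. *)
Definition hcomp (K : fieldType) (I : Type) (A : algType K) (wt : I -> nat)
    (a : I -> A) (d : nat) (u : A) : Prop :=
  exists2 p : ncpoly K I, nchomog wt d p & u = nceval a p.

(** * Normal elements *)

Section Normal.
Variable E : nzRingType.

Definition normal_elt (u : E) : Prop :=
  (forall e, exists f, u * e = f * u) /\ (forall e, exists f, e * u = u * f).

Definition two_sided_ideal (S : E -> Prop) (u : E) : Prop :=
  exists (m : nat) (l g r : 'I_m -> E),
    (forall i, S (g i)) /\ u = \sum_i l i * g i * r i.

(* The image of [u] is normal in [E / <S>]. *)
Definition normal_mod (S : E -> Prop) (u : E) : Prop :=
  (forall e, exists f, two_sided_ideal S (u * e - f * u)) /\
  (forall e, exists f, two_sided_ideal S (e * u - u * f)).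

Definition normalizing_seq n (z : 'I_n -> E) : Prop :=
  forall k : 'I_n,
    normal_mod (fun v => exists2 l : 'I_n, (l < k)%N & v = z l) (z k).

End Normal.

(** * Graded (skew) Clifford algebras

    Variables are indexed by ['I_n + 'I_n]: [inl i] is the degree-one generator
    [x i], and [inr k] the degree-two generator [y k]. *)

Section Clifford.
Variables (K : fieldType) (n : nat).

Definition cwt (s : 'I_n + 'I_n) : nat := if s is inl _ then 1%N else 2%N.

Definition cgen (A : algType K) (x y : 'I_n -> A) (s : 'I_n + 'I_n) : A :=
  match s with inl i => x i | inr k => y k end.

Definition cgrading (A : algType K) (x y : 'I_n -> A) : nat -> A -> Prop :=
  hcomp cwt (cgen x y).

(* x_i x_j + mu_ij x_j x_i - \sum_k (M_k)_ij y_k *)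
Definition clifford_rel (mu : 'M[K]_n) (M : 'I_n -> 'M[K]_n) (i j : 'I_n) :
    ncpoly K ('I_n + 'I_n) :=
  [:: (1, [:: inl i; inl j]), (mu i j, [:: inl j; inl i])
    & [seq (- M k i j, [:: inr k]) | k <- enum 'I_n]].

Definition mu_symmetric (mu M : 'M[K]_n) : Prop :=
  forall i j, M i j = mu i j * M j i.

Definition is_GSCA (mu : 'M[K]_n) (M : 'I_n -> 'M[K]_n)
    (A : algType K) (x y : 'I_n -> A) : Prop :=
  [/\ (forall i j, i != j -> mu i j * mu j i = 1) /\ (forall i, mu i i = 1),
      forall k, mu_symmetric mu (M k)
    & exists relb : ncpoly K ('I_n + 'I_n) -> Prop,
      [/\ forall p, relb p -> nchomog cwt 3%N p \/ nchomog cwt 4%N p,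
          presented (cgen x y)
            (fun p => (exists i j, p = clifford_rel mu M i j) \/ relb p)
        & exists y' : 'I_n -> A,
            normalizing_seq y' /\ forall u, lspan y' u <-> lspan y u]].

Definition is_GCA (N : 'I_n -> 'M[K]_n) (B : algType K) (X Y : 'I_n -> B) :
    Prop :=
  (forall k, (N k)^T = N k) /\
  presented (cgen X Y)
    (fun p => (exists i j, p = clifford_rel (const_mx 1) N i j) \/
       (exists k s, p = [:: (1, [:: inr k; s]); (-1, [:: s; inr k])])).

Definition quadratic (A : algType K) (gr : nat -> A -> Prop) : Prop :=
  exists (m : nat) (v : 'I_m -> A) (rel : ncpoly K 'I_m -> Prop),
  [/\ forall i, gr 1%N (v i),
      forall p, rel p -> nchomog (fun=> 1%N) 2%N p
    & presented v rel].

(* 'C(n + d - 1, d) is the coefficient of t^d in 1 / (1 - t)^n, also for n = 0. *)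
Definition regular (A : algType K) (gr : nat -> A -> Prop) : Prop :=
  [/\ quadratic gr, auslander_regular A n, cohen_macaulay A
    & forall d, has_dim *:%R (gr d) 'C((n + d).-1, d)%N].

End Clifford.

(** * Twists

    A graded algebra may carry many systems of Clifford generators, so a twist
    of [B] can be a graded skew Clifford algebra whose [y k] have nothing to do
    with the [Y k].  For instance k<u,v>/(vu - quv) is a twist of the graded
    Clifford algebra k<u,v>/(vu + uv), with Y = u^2, v^2, and is also a graded
    skew Clifford algebra on x = u + v, u - v and y = uv, u^2 + v^2; for generic
    [q] these [y k] do not generate a skew polynomial ring.  A twist of Clifford
    algebras given with their generators therefore has to identify the span of
    the [Y k] with that of the [y k]. *)

Section Twist.
Variable K : fieldType.

Definition graded_aut (D : algType K) (gr : nat -> D -> Prop)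
    (phi : {lrmorphism D -> D}) : Prop :=
  bijective phi /\ forall d u, gr d u -> gr d (phi u).

(* [theta], which is written a |-> a' in the literature, identifies [D'] with
   the twist of [D] by [phi]: a' * b' = (a phi^i(b))' for [a] of degree [i]. *)
Definition twist_via (D D' : algType K) (gr : nat -> D -> Prop)
    (gr' : nat -> D' -> Prop) (phi : {lrmorphism D -> D})
    (theta : {linear D -> D'}) : Prop :=
  [/\ bijective theta,
      forall d u, gr d u <-> gr' d (theta u)
    & forall i j a b, gr i a -> gr j b ->
        theta a * theta b = theta (a * iter i phi b)].

Definition is_twist (D D' : algType K) (gr : nat -> D -> Prop)
    (gr' : nat -> D' -> Prop) : Prop :=
  exists (phi : {lrmorphism D -> D}) (theta : {linear D -> D'}),
    graded_aut gr phi /\ twist_via gr gr' phi theta.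

End Twist.

(** * The subalgebra generated by a family *)

Section Subalgebra.
Variables (K : fieldType) (I : Type) (A : algType K) (a : I -> A).

Definition subalg_pred : {pred A} := fun u => `[< exists p, u = nceval a p >].

Lemma subalg_pred_closed : GRing.subsemialg_closed subalg_pred.
Proof.
have catE p q : nceval a (p ++ q) = nceval a p + nceval a q.
  by rewrite /nceval big_cat.
have scE c p : c *: nceval a p = nceval a [seq (c * t.1, t.2) | t <- p].
  rewrite /nceval big_map scaler_sumr.
  by apply: eq_bigr => t _; rewrite scalerA.
have mulE p q : nceval a p * nceval a q =
    nceval a [seq (s.1 * t.1, s.2 ++ t.2) | s <- p, t <- q].
  rewrite /nceval big_allpairs_dep mulr_suml; apply: eq_bigr => s _.
  rewrite mulr_sumr; apply: eq_bigr => t _.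
  by rewrite big_cat -scalerAl -scalerAr scalerA.
split.
- apply/asboolP; exists [:: (1, [::])].
  by rewrite /nceval big_seq1 big_nil scale1r.
- split; first by apply/asboolP; exists [::]; rewrite /nceval big_nil.
  move=> _ _ /asboolP[p ->] /asboolP[q ->].
  by apply/asboolP; exists (p ++ q); rewrite catE.
- move=> c _ /asboolP[p ->].
  by apply/asboolP; exists [seq (c * t.1, t.2) | t <- p]; rewrite scE.
- move=> _ _ /asboolP[p ->] /asboolP[q ->].
  by apply/asboolP; exists [seq (s.1 * t.1, s.2 ++ t.2) | s <- p, t <- q].
Qed.

HB.instance Definition _ :=
  GRing.isSubalgClosed.Build K A subalg_pred subalg_pred_closed.

Record subalg := Subalg { subalg_val : A; _ : subalg_val \in subalg_pred }.

HB.instance Definition _ := [isSub for subalg_val].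
HB.instance Definition _ := [Choice of subalg by <:].
HB.instance Definition _ := [SubChoice_isSubAlgebra of subalg by <:].

End Subalgebra.

(* The grading inherited by a subalgebra. *)
Definition sub_grading (K : fieldType) (I : Type) (A : algType K) (a : I -> A)
    (gr : nat -> A -> Prop) : nat -> subalg a -> Prop :=
  fun d u => gr d (val u).

(** * Skew polynomial rings *)

Section SkewPolynomial.
Variables (K : fieldType) (n : nat).

Definition skew_rels (q : 'I_n -> 'I_n -> K) : seq (ncpoly K 'I_n) :=
  [seq [:: (1, [:: ij.2; ij.1]); (- q ij.1 ij.2, [:: ij.1; ij.2])]
     | ij <- enum [pred ij : 'I_n * 'I_n | ij.1 < ij.2]%N].

Lemma size_skew_rels q : size (skew_rels q) = ((n * n.-1) %/ 2)%N.
Proof.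
rewrite size_map -cardE -sum1_card divn2 -bin2 -bin2_sum big_mkord.
rewrite -(pair_big_dep predT (fun i j : 'I_n => i < j)%N (fun _ _ => 1%N)) /=.
rewrite (exchange_big_dep predT) //=; apply: eq_bigr => j _.
by rewrite (big_ord_narrow (ltnW (ltn_ord j))) sum_nat_const card_ord muln1.
Qed.

(* Normality depends on the basis: in k<u,v>/(vu - quv), the subalgebra
   generated by y = u^2, u^2 + v^2 is a skew polynomial ring on u^2, v^2, although
   u^2 + v^2 is not normal in it for generic [q].

   [S] is a skew polynomial ring on [z]: a domain with n(n-1)/2 defining
   relations z_j z_i = q_ij z_i z_j (i < j, q_ij nonzero), which make every
   [z k] normal in [S]. *)
Definition skew_polynomial (S : algType K) (z : 'I_n -> S) : Prop :=
  [/\ forall u v : S, u * v = 0 -> u = 0 \/ v = 0,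
      exists q : 'I_n -> 'I_n -> K,
        (forall i j, q i j != 0) /\
        presented z (fun p => p \in skew_rels q)
    & forall k, normal_elt (z k)].

End SkewPolynomial.

(* Main.v *)
From HB Require Import structures.
Require Import Defs.
From mathcomp Require Import all_boot all_order all_algebra.
From mathcomp Require Import mpoly.

Set Implicit Arguments.
Unset Strict Implicit.
Unset Printing Implicit Defensive.

Import Order.TTheory GRing.Theory.
Local Open Scope ring_scope.

(** Write [theta : B -> A] for the identification of the twist, [V] for the span
    of the [Y k] (so that [theta] maps [V] onto the span of the [y k]), and let
    [a i] be the element of [B] with [theta (a i) = x i].

    Counting.  Modulo its relations a graded Clifford algebra is spanned by the
    products of an ordered squarefree monomial in the degree-one generators and
    a monomial in the central degree-two generators.  In degree [d] there are
    'C(n + d - 1, d) of them, because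
    (1 + t)^n / (1 - t^2)^n = 1 / (1 - t)^n, and this is the dimension that
    regularity of [A] imposes on [B].  Hence these monomials are independent
    ([clifford_mon_free]); the argument applies to any [n] elements spanning degree one and any
    [n] elements spanning [V], so to the [a i] and to every basis of [V].
    In particular the subalgebra [C] is a polynomial ring, and modulo [V] the
    degree-two part of [B] is that of an exterior algebra
    ([symmetric_coefficients]).

    Diagonalization.  As [mu i i = 1], twice [x i x i] lies in the span of the
    [y k], so [a i (tau (a i))] lies in [V]; in the exterior algebra two
    elements of degree one have product zero only when they are proportional, so
    each [a i] is an eigenvector of [tau].  Since [A] is generated in degree one
    so is [B], and then [V] is spanned by the anticommutators of the [a i], which
    are eigenvectors too ([tau_eigenbasis]).

    Conclusion.  Let [Z] be a basis of [V] with [tau^2 (Z k) = rho k Z k].  Then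
    [theta (Z i) theta (Z j) = rho j theta (Z i Z j)], so the [theta (Z k)]
    commute up to ratios of the [rho k], and their ordered monomials are nonzero
    multiples of the images of the independent commutative monomials.  Such
    elements generate a skew polynomial ring ([skew_polynomial_of_free]): any two
    algebras with these commutation rules multiply ordered monomials with the
    same scalars.  A basis of eigenvectors of [tau] gives elements normal in [A],
    and [tau] and [theta] restrict to the subalgebras, which exhibits [R] as a
    twist of [C].  Conversely an element of the span of the [y k] that is normal
    in [R] comes from an eigenvector of [tau^2] ([normal_eigen]), so every basis
    of normal elements is covered. *)

(** * Spans and dimension counts *)

Section Span.
Variables (K : fieldType) (U : lmodType K).

Lemma lspan_gen m (b : 'I_m -> U) i : lspan b (b i).
Proof.
exists (fun j => (j == i)%:R); rewrite (bigD1 i) //= eqxx scale1r big1 ?addr0 //.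
by move=> j /negPf ->; rewrite scale0r.
Qed.

Lemma lspan0 m (b : 'I_m -> U) : lspan b 0.
Proof. by exists (fun=> 0); rewrite big1 // => i _; rewrite scale0r. Qed.

Lemma lspanD m (b : 'I_m -> U) u v : lspan b u -> lspan b v -> lspan b (u + v).
Proof.
move=> [c ->] [c' ->]; exists (fun i => c i + c' i).
by rewrite -big_split; apply: eq_bigr => i _; rewrite scalerDl.
Qed.

Lemma lspanZ m (b : 'I_m -> U) k u : lspan b u -> lspan b (k *: u).
Proof.
move=> [c ->]; exists (fun i => k * c i).
by rewrite scaler_sumr; apply: eq_bigr => i _; rewrite scalerA.
Qed.

Lemma lspan_sum m (b : 'I_m -> U) T (s : seq T) (P : pred T) F :
  (forall t, P t -> lspan b (F t)) -> lspan b (\sum_(t <- s | P t) F t).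
Proof.
move=> h; elim/big_ind: _ => [|u v|i]; [exact: lspan0 | exact: lspanD | exact: h].
Qed.

Lemma lspan_trans m m' (b : 'I_m -> U) (b' : 'I_m' -> U) u :
  (forall i, lspan b' (b i)) -> lspan b u -> lspan b' u.
Proof. by move=> h [c ->]; apply: lspan_sum => i _; apply: lspanZ. Qed.

(** A spanning family whose size is the dimension is free: writing a basis in
    terms of the family and back gives two square matrices with product 1, and
    one-sided inverses of square matrices are two-sided. *)
Lemma spanning_free (P : U -> Prop) d (v : 'I_d -> U) :
  has_dim *:%R P d -> (forall i, P (v i)) -> (forall u, P u -> lspan v u) ->
  forall c, \sum_i c i *: v i = 0 -> forall i, c i = 0.
Proof.
move=> [b [Pb freeb spanb]] Pv spanv c c0.
have /fin_all_exists [p vE] i := spanb _ (Pv i).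
have /fin_all_exists [q bE] i := spanv _ (Pb i).
pose mp := \matrix_(i, j) p i j; pose mq := \matrix_(i, j) q i j.
have comb (x : 'I_d -> K) (y : 'I_d -> 'I_d -> K) (w : 'I_d -> U) :
    \sum_i x i *: (\sum_j y i j *: w j) = \sum_j (\sum_i x i * y i j) *: w j.
  under eq_bigr do rewrite scaler_sumr.
  rewrite exchange_big; apply: eq_bigr => j _.
  by rewrite scaler_suml; apply: eq_bigr => i _; rewrite scalerA.
have qp1 : mq *m mp = 1%:M.
  apply/matrixP => i j; rewrite !mxE; under eq_bigr do rewrite !mxE.
  apply/eqP; rewrite -subr_eq0; apply/eqP.
  apply: (freeb (fun j => \sum_k q i k * p k j - (i == j)%:R)).
  under eq_bigr do rewrite scalerBl.
  rewrite sumrB -comb; under eq_bigr do rewrite -vE.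
  rewrite -bE (bigD1 i) //= eqxx scale1r big1 ?addr0 ?subrr // => k.
  by rewrite eq_sym => /negPf ->; rewrite scale0r.
have pq1 := mulmx1C qp1.
have cp0 : (\row_i c i) *m mp = 0.
  apply/rowP => j; rewrite !mxE; under eq_bigr do rewrite !mxE.
  apply: (freeb (fun j => \sum_k c k * p k j)).
  by rewrite -comb -[RHS]c0; apply: eq_bigr => i _; rewrite -vE.
move=> i; have /rowP/(_ i) : \row_i c i = 0.
  by rewrite -[LHS]mulmx1 -pq1 mulmxA cp0 mul0mx.
by rewrite !mxE.
Qed.

End Span.

(** * Evaluation of noncommutative polynomials *)

Section Eval.
Variables (K : fieldType) (I : Type) (A : algType K) (a : I -> A).

Lemma nceval_cat p q : nceval a (p ++ q) = nceval a p + nceval a q.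
Proof. by rewrite /nceval big_cat. Qed.

Lemma nceval1 : nceval a [:: (1, [::])] = 1.
Proof. by rewrite /nceval big_seq1 big_nil scale1r. Qed.

Lemma nceval_scale c p : nceval a [seq (c * t.1, t.2) | t <- p] = c *: nceval a p.
Proof.
rewrite /nceval big_map scaler_sumr.
by apply: eq_bigr => t _; rewrite scalerA.
Qed.

Lemma nceval_mul p q :
  nceval a [seq (s.1 * t.1, s.2 ++ t.2) | s <- p, t <- q] = nceval a p * nceval a q.
Proof.
rewrite /nceval big_allpairs_dep mulr_suml; apply: eq_bigr => s _.
rewrite mulr_sumr; apply: eq_bigr => t _.
by rewrite big_cat -scalerAl -scalerAr scalerA.
Qed.

Lemma nceval_gen i : nceval a [:: (1, [:: i])] = a i.
Proof. by rewrite /nceval !big_seq1 scale1r. Qed.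

Lemma nceval_ind (P : A -> Prop) :
  P 1 -> (forall u v, P u -> P v -> P (u + v)) -> (forall c u, P u -> P (c *: u)) ->
  (forall i u, P u -> P (a i * u)) -> forall p, P (nceval a p).
Proof.
move=> P1 PD PZ PM p; elim: p => [|t p IH].
  by rewrite /nceval big_nil -(scale0r 1); apply: PZ.
rewrite /nceval big_cons; apply: (PD) IH; apply: PZ.
by elim: t.2 => [|i w IH]; rewrite ?big_nil ?big_cons //; apply: PM.
Qed.

Lemma nceval_in_subalg p : nceval a p \in subalg_pred a.
Proof. by apply/boolp.asboolP; exists p. Qed.

Lemma subalgP u : u \in subalg_pred a -> exists p, u = nceval a p.
Proof. by move/boolp.asboolP. Qed.

Lemma gen_in_subalg i : a i \in subalg_pred a.
Proof. by rewrite -nceval_gen nceval_in_subalg. Qed.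

Lemma lspan_in_subalg m (b : 'I_m -> A) u :
  (forall i, b i \in subalg_pred a) -> lspan b u -> u \in subalg_pred a.
Proof. by move=> h [c ->]; apply: rpred_sum => i _; apply: rpredZ. Qed.

Lemma subalg_ind (P : A -> Prop) :
  P 1 -> (forall u v, P u -> P v -> P (u + v)) -> (forall c u, P u -> P (c *: u)) ->
  (forall i u, P u -> P (a i * u)) -> forall u, u \in subalg_pred a -> P u.
Proof. by move=> P1 PD PZ PM u /subalgP [p ->]; apply: nceval_ind. Qed.

End Eval.

Lemma rmorph_nceval (K : fieldType) (I : Type) (A D : algType K)
    (f : {lrmorphism A -> D}) (a : I -> A) p :
  f (nceval a p) = nceval (f \o a) p.
Proof.
rewrite /nceval linear_sum; apply: eq_bigr => t _.
by rewrite linearZ /= rmorph_prod.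
Qed.

Lemma subalg_sub (K : fieldType) (I J : Type) (A : algType K) (a : I -> A)
    (b : J -> A) u :
  (forall i, a i \in subalg_pred b) -> u \in subalg_pred a -> u \in subalg_pred b.
Proof.
move=> h; move: u; apply: subalg_ind => [|u v|c u|i u].
- exact: rpred1.
- exact: rpredD.
- exact: rpredZ.
- exact: rpredM.
Qed.

(** * The grading defined by weighted generators *)

Section Grading.
Variables (K : fieldType) (I : Type) (A : algType K) (wt : I -> nat) (a : I -> A).
Notation gr := (hcomp wt a).

Lemma hcomp0 d : gr d 0.
Proof. by exists [::]; rewrite ?/nceval ?big_nil. Qed.

Lemma hcompD d u v : gr d u -> gr d v -> gr d (u + v).
Proof.
move=> [p hp ->] [q hq ->]; exists (p ++ q); last by rewrite nceval_cat.
by rewrite /nchomog all_cat; apply/andP.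
Qed.

Lemma hcompZ d c u : gr d u -> gr d (c *: u).
Proof.
move=> [p hp ->]; exists [seq (c * t.1, t.2) | t <- p]; last by rewrite nceval_scale.
by rewrite /nchomog all_map.
Qed.

Lemma hcomp1 : gr 0%N 1.
Proof.
by exists [:: (1, [::])]; rewrite ?nceval1 // /nchomog /= big_nil eqxx.
Qed.

Lemma hcomp_gen i : gr (wt i) (a i).
Proof.
by exists [:: (1, [:: i])]; rewrite ?nceval_gen // /nchomog /= big_seq1 eqxx.
Qed.

Lemma hcompM d e u v : gr d u -> gr e v -> gr (d + e)%N (u * v).
Proof.
move=> [p hp ->] [q hq ->].
exists [seq (s.1 * t.1, s.2 ++ t.2) | s <- p, t <- q]; last by rewrite nceval_mul.
elim: p hp => //= s p IH /andP [hs hp].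
rewrite /nchomog all_cat all_map; apply/andP; split; last exact: IH.
apply: sub_all hq => t /eqP /= <-.
by rewrite big_cat /= (eqP hs).
Qed.

Lemma hcomp_sum d T (s : seq T) (P : pred T) F :
  (forall t, P t -> gr d (F t)) -> gr d (\sum_(t <- s | P t) F t).
Proof.
move=> h; elim/big_ind: _ => [|u v|i]; [exact: hcomp0 | exact: hcompD | exact: h].
Qed.

Lemma hcomp_lspan d m (b : 'I_m -> A) u : (forall i, gr d (b i)) -> lspan b u -> gr d u.
Proof. by move=> h [c ->]; apply: hcomp_sum => i _; apply: hcompZ. Qed.

Lemma hcomp_word w : gr (\sum_(i <- w) wt i)%N (\prod_(i <- w) a i).
Proof.
elim: w => [|i w IH]; rewrite ?big_nil ?big_cons; first exact: hcomp1.
exact: hcompM (hcomp_gen i) IH.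
Qed.

Lemma hcomp_min (P : nat -> A -> Prop) :
  (forall d, P d 0) -> (forall d u v, P d u -> P d v -> P d (u + v)) ->
  (forall d c u, P d u -> P d (c *: u)) -> P 0%N 1 ->
  (forall d i u, P d u -> P (wt i + d)%N (a i * u)) ->
  forall d u, gr d u -> P d u.
Proof.
move=> P0 PD PZ P1 PM d u [p hp ->]; elim: p hp => [|t p IH] /=.
  by rewrite /nceval big_nil.
case/andP => ht /IH hp; rewrite /nceval big_cons; apply: PD hp; apply: PZ.
rewrite -(eqP ht) {ht}.
by elim: t.2 => [|i w IHw]; rewrite ?big_nil ?big_cons //; apply: PM.
Qed.

Lemma homog_ind (P : A -> Prop) :
  (forall u, exists p, u = nceval a p) ->
  P 0 -> (forall u v, P u -> P v -> P (u + v)) -> (forall d u, gr d u -> P u) ->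
  forall u, P u.
Proof.
move=> gen P0 PD Ph u; have [p ->] := gen u.
rewrite /nceval; elim/big_ind: _ => // t _.
by apply: Ph (hcompZ _ (hcomp_word _)).
Qed.

End Grading.

Lemma hcomp_sub (K : fieldType) (I J : Type) (A : algType K) (wt : I -> nat)
    (wt' : J -> nat) (a : I -> A) (b : J -> A) :
  (forall i, hcomp wt' b (wt i) (a i)) ->
  forall d u, hcomp wt a d u -> hcomp wt' b d u.
Proof.
move=> h; apply: hcomp_min.
- exact: hcomp0.
- by move=> *; apply: hcompD.
- by move=> *; apply: hcompZ.
- exact: hcomp1.
- by move=> *; apply: hcompM.
Qed.

(** The sums range over lists in which a degree may occur several times; this is
    the form in which the terms of an evaluated polynomial come. *)
Definition independent_grading (K : fieldType) (U : lmodType K)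
    (gr : nat -> U -> Prop) : Prop :=
  forall (T : Type) (s : seq T) (dg : T -> nat) (u : T -> U),
    (forall t, gr (dg t) (u t)) -> \sum_(t <- s) u t = 0 ->
    forall d, \sum_(t <- s | dg t == d) u t = 0.

Section Independence.
Variable K : closedFieldType.

Lemma closed_field_uniq m : exists2 s : seq K, uniq s & size s = m.
Proof.
elim: m => [|m [s us sm]]; first by exists [::].
have nz : 'X * \prod_(x <- s) ('X - x%:P) != 0.
  by rewrite mulf_neq0 ?polyX_eq0 ?monic_neq0 ?monic_prod_XsubC.
have /closed_nonrootP [x] := nz.
rewrite rootM root_prod_XsubC negb_or => /andP [_ xs].
by exists (x :: s); rewrite /= ?xs ?sm.
Qed.

Lemma vandermonde_dual m : exists x : 'I_m -> K, exists q : 'I_m -> 'I_m -> K,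
  forall d e : 'I_m, \sum_j q j e * x j ^+ d = (d == e)%:R.
Proof.
have [s us sm] := closed_field_uniq m.
pose x := \row_(j < m) s`_j; pose V := Vandermonde m x.
have Vu : V \in unitmx.
  rewrite unitmxE det_Vandermonde unitfE; apply/prodf_neq0 => i _.
  apply/prodf_neq0 => j ij; rewrite !mxE subr_eq0 nth_uniq ?sm //.
  by rewrite gtn_eqF.
exists (fun j => s`_j), (fun j e => (invmx V) j e) => d e.
have /matrixP/(_ d e) := mulmxV Vu; rewrite !mxE => <-.
by apply: eq_bigr => j _; rewrite !mxE mulrC.
Qed.

(** Homogeneous relations make the induced grading independent: for every scalar
    [c] the substitution [a i |-> c^(wt i) a i] respects the relations, so it
    extends to an endomorphism acting on degree [d] as [c^d]; since the field is
    infinite, a Vandermonde system separates the degrees. *)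
Lemma presented_independent (I : Type) (A : algType K) (wt : I -> nat) (a : I -> A)
    (rel : ncpoly K I -> Prop) :
  presented a rel -> (forall p, rel p -> exists d, nchomog wt d p) ->
  independent_grading (hcomp wt a).
Proof.
move=> [_ rel0 univ] relh.
have word_scale (c : K) w : \prod_(i <- w) (c ^+ wt i *: a i) =
    c ^+ (\sum_(i <- w) wt i)%N *: \prod_(i <- w) a i.
  elim: w => [|i w IH]; rewrite ?big_nil ?expr0 ?scale1r // !big_cons IH.
  by rewrite -scalerAl -scalerAr scalerA -exprD.
have eval_scale c d p : nchomog wt d p ->
    nceval (fun i => c ^+ wt i *: a i) p = c ^+ d *: nceval a p.
  elim: p => [|t p IH] /=; first by rewrite /nceval !big_nil scaler0.
  case/andP => /eqP ht /IH {}IH.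
  rewrite /nceval !big_cons -!/(nceval _ _) IH word_scale ht.
  by rewrite scalerDr !scalerA mulrC.
have scale_map (c : K) : exists f : {lrmorphism A -> A},
    forall d u, hcomp wt a d u -> f u = c ^+ d *: u.
  have [p hp|f fE] := univ A (fun i => c ^+ wt i *: a i).
    have [d hd] := relh p hp.
    by rewrite (eval_scale _ _ _ hd) (rel0 _ hp) scaler0.
  exists f => d u [p hp ->]; rewrite rmorph_nceval -(eval_scale _ _ _ hp).
  rewrite /nceval; apply: eq_bigr => t _; congr (_ *: _).
  by apply: eq_bigr => i _; apply: fE.
move=> T s dg u uh u0 d.
pose m := (maxn d (\max_(t <- s) dg t)).+1.
have dg_lt : all (fun t => dg t < m)%N s.
  have: all (fun t => dg t <= \max_(t <- s) dg t)%N s.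
    elim: (s) => //= t s' IH; rewrite big_cons leq_maxl /=.
    by apply: sub_all IH => t' h; rewrite (leq_trans h) ?leq_maxr.
  by apply: sub_all => t h; rewrite ltnS (leq_trans h) ?leq_maxr.
have d_lt : (d < m)%N by rewrite ltnS leq_maxl.
have [x [q qx]] := vandermonde_dual m.
pose w := q ^~ (Ordinal d_lt).
have wx e : (e < m)%N -> \sum_j w j * x j ^+ e = (e == d)%:R.
  by move=> h; rewrite (qx (Ordinal h)).
have xj0 j : \sum_(t <- s) x j ^+ dg t *: u t = 0.
  have [f fE] := scale_map (x j).
  transitivity (f (\sum_(t <- s) u t)); last by rewrite u0 raddf0.
  rewrite raddf_sum; apply: eq_bigr => t _.
  by apply/esym/fE/uh.
have <- : \sum_j w j *: (\sum_(t <- s) x j ^+ dg t *: u t) =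
    \sum_(t <- s | dg t == d) u t.
  under eq_bigr do rewrite scaler_sumr.
  rewrite exchange_big /=.
  elim: (s) dg_lt => [|t s' IH] /=; first by rewrite !big_nil.
  move=> /andP [lt_t lt_s]; rewrite !big_cons IH //.
  under eq_bigr do rewrite scalerA.
  by rewrite -scaler_suml wx //; case: eqP => _; rewrite ?scale1r ?scale0r ?add0r.
by rewrite big1 // => j _; rewrite xj0 scaler0.
Qed.

End Independence.

(** * Linear maps out of a polynomial ring *)

Section LinearExtension.
Variables (K : fieldType) (n : nat) (U : lmodType K) (g : 'X_{1..n} -> U).

Definition lext (p : {mpoly K[n]}) : U := \sum_(m <- msupp p) p@_m *: g m.

Lemma lext_big (s : seq 'X_{1..n}) p : uniq s -> {subset msupp p <= s} ->
  lext p = \sum_(m <- s) p@_m *: g m.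
Proof.
move=> us sub; rewrite (bigID (mem (msupp p))) /= addrC big1 ?add0r; last first.
  by move=> m /memN_msupp_eq0 ->; rewrite scale0r.
rewrite -big_filter; apply: perm_big; apply: uniq_perm => [||m].
- exact: msupp_uniq.
- exact: filter_uniq.
- by rewrite mem_filter; case: (boolP (m \in msupp p)) => //= /sub ->.
Qed.

Lemma lext_is_linear : linear lext.
Proof.
move=> c p q; pose s := undup (msupp (c *: p + q) ++ msupp p ++ msupp q).
have us : uniq s by exact: undup_uniq.
rewrite !(@lext_big s) //; try by move=> m hm; rewrite mem_undup !mem_cat hm ?orbT.
rewrite scaler_sumr -big_split; apply: eq_bigr => m _.
by rewrite mcoeffD mcoeffZ scalerDl scalerA.
Qed.

HB.instance Definition _ :=
  GRing.isLinear.Build K {mpoly K[n]} U _ lext lext_is_linear.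

Lemma lextX m : lext 'X_[m] = g m.
Proof. by rewrite /lext msuppX big_seq1 mcoeffX eqxx scale1r. Qed.

End LinearExtension.

Lemma eq_lext (K : fieldType) n (U : lmodType K) (g h : 'X_{1..n} -> U) :
  g =1 h -> lext g =1 lext h.
Proof. by move=> e p; apply: eq_bigr => m _; rewrite e. Qed.

Lemma linear_lext (K : fieldType) n (U V : lmodType K) (f : {linear U -> V})
    (g : 'X_{1..n} -> U) p : f (lext g p) = lext (fun m => f (g m)) p.
Proof. by rewrite [in LHS]/lext linear_sum; apply: eq_bigr => m _; rewrite linearZ. Qed.

Lemma mcoeff_sumX (K : fieldType) n (s : seq 'X_{1..n}) (P : pred 'X_{1..n})
    (c : 'X_{1..n} -> K) m : uniq s ->
  (\sum_(k <- s | P k) c k *: 'X_[k] : {mpoly K[n]})@_m =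
    if (m \in s) && P m then c m else 0.
Proof.
move=> us; rewrite raddf_sum /=; under eq_bigr do rewrite mcoeffZ mcoeffX.
case: ifP => [/andP [ms Pm]|h].
  rewrite (big_rem m) //= Pm eqxx mulr1 big_seq_cond big1 ?addr0 // => k.
  by rewrite mem_rem_uniq // => /andP [/andP [/= /negPf -> _] _]; rewrite mulr0.
rewrite big_seq_cond big1 // => k /andP [ks Pk].
by case: eqP => [e|_]; rewrite ?mulr0 //; move: h; rewrite -e ks Pk.
Qed.

Lemma mcoeff_lext_scale (K : fieldType) n (c : 'X_{1..n} -> K) (p : {mpoly K[n]}) m :
  (lext (fun k => c k *: 'X_[k]) p)@_m = c m * p@_m.
Proof.
rewrite /lext; under eq_bigr do rewrite scalerA.
rewrite mcoeff_sumX ?msupp_uniq // andbT mulrC.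
by case: ifP => // /negbT/memN_msupp_eq0 ->; rewrite mulr0.
Qed.

Lemma size_monomials n d :
  size [seq s2m t | t : d.-tuple 'I_n <- enum (basis n d)] = 'C((n + d).-1, d).
Proof.
case: n => [|n]; last by rewrite size_basis addSn addnC.
case: d => [|d].
  have := uniq_basis 0 0.
  have: 0%MM \in [seq s2m t | t : 0.-tuple 'I_0 <- enum (basis 0 0)].
    by rewrite -basis_cover mdeg0.
  case: [seq s2m _ | _ <- _] => [|m [|m' s]] //=.
  by rewrite inE negb_or (nvar0_mnmE m) (nvar0_mnmE m') eqxx.
rewrite add0n bin_small //.
case E: [seq s2m _ | _ <- _] => [|m s] //=.
have: m \in [seq s2m t | t : d.+1.-tuple 'I_0 <- enum (basis 0 d.+1)].
  by rewrite E mem_head.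
by rewrite -basis_cover (nvar0_mnmE m) mdeg0.
Qed.

(** * Ordered monomials in a Clifford system *)

Section CliffordMonomials.
Variables (K : fieldType) (n : nat) (B : algType K) (a z : 'I_n -> B).
Hypothesis two_neq0 : 2%:R != 0 :> K.
Hypothesis z_central : forall k u, z k * u = u * z k.
Hypothesis anticomm : forall i j, lspan z (a i * a j + a j * a i).

Notation gr := (hcomp (@cwt n) (cgen a z)).

Definition half_mnm (e : 'X_{1..n}) : 'X_{1..n} := [multinom (e i)./2 | i < n].

Lemma half_mnmE e i : half_mnm e i = (e i)./2.
Proof. exact: mnmE. Qed.

(** The exponent [e i] is split as [e i = odd (e i) + 2 * (e i)./2], the first
    part counting the generator [a i] of degree one and the second one the
    generator [z i] of degree two.  This encodes the ordered monomials of degree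
    [d] by the commutative monomials of degree [d], whose number is known. *)
Definition partial_mon (s : seq 'I_n) (e : 'X_{1..n}) : B :=
  (\prod_(i <- s) a i ^+ odd (e i)) * mmap1 z (half_mnm e).

Definition clifford_mon (e : 'X_{1..n}) : B :=
  (\prod_(i < n) a i ^+ odd (e i)) * mmap1 z (half_mnm e).

Let odd_in (s : seq 'I_n) (e : 'X_{1..n}) := [forall i, (i \notin s) ==> ~~ odd (e i)].

(** Straightening goes by induction on the list [s] of the generators of degree
    one that may occur.  Outside [s] the exponents are even, so that every factor
    [z i] stays available. *)
Let span_on (s : seq 'I_n) (d : nat) (u : B) : Prop :=
  exists2 L : seq (K * 'X_{1..n}),
    all (fun t => (mdeg t.2 == d) && odd_in s t.2) L &
    u = \sum_(t <- L) t.1 *: partial_mon s t.2.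

Let span_on0 s d : span_on s d 0.
Proof. by exists [::]; rewrite ?big_nil. Qed.

Let span_onD s d u v : span_on s d u -> span_on s d v -> span_on s d (u + v).
Proof.
move=> [L hL ->] [L' hL' ->]; exists (L ++ L'); last by rewrite big_cat.
by rewrite all_cat hL.
Qed.

Let span_onZ s d c u : span_on s d u -> span_on s d (c *: u).
Proof.
move=> [L hL ->]; exists [seq (c * t.1, t.2) | t <- L]; first by rewrite all_map.
by rewrite big_map scaler_sumr; apply: eq_bigr => t _; rewrite scalerA.
Qed.

Let span_on_mon s e : odd_in s e -> span_on s (mdeg e) (partial_mon s e).
Proof.
move=> h; exists [:: (1, e)]; first by rewrite /= eqxx h.
by rewrite big_seq1 scale1r.
Qed.

Let span_on_ind s d (P : B -> Prop) :
  P 0 -> (forall u v, P u -> P v -> P (u + v)) -> (forall c u, P u -> P (c *: u)) ->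
  (forall e, mdeg e = d -> odd_in s e -> P (partial_mon s e)) ->
  forall u, span_on s d u -> P u.
Proof.
move=> P0 PD PZ Pm u [L + ->]; elim: L => [|t L IH] /=; first by rewrite big_nil.
case/andP => /andP [/eqP ht ot] /IH hL; rewrite big_cons.
by apply: PD hL; apply: PZ; apply: Pm.
Qed.

Let odd_inP s (e : 'X_{1..n}) : reflect (forall i, i \notin s -> ~~ odd (e i)) (odd_in s e).
Proof. exact: forall_inP. Qed.

Let mmap1_addU m k : mmap1 z (m + U_(k))%MM = z k * mmap1 z m.
Proof. by rewrite commr_mmap1_M ?mmap1U ?z_central // => i u; rewrite /GRing.comm z_central. Qed.

Let span_on_zM s d k u : span_on s d u -> span_on s d.+2 (z k * u).
Proof.
move: u; apply: span_on_ind => [|u v|c u|e <- oe]; first by rewrite mulr0.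
- by rewrite mulrDr; apply: span_onD.
- by rewrite -scalerAr; apply: span_onZ.
pose f := (e + (U_(k) + U_(k)))%MM.
have odd_f i : odd (f i) = odd (e i) by rewrite !mnmDE addnn oddD odd_double addbF.
have -> : z k * partial_mon s e = partial_mon s f.
  rewrite /partial_mon mulrA z_central -mulrA -mmap1_addU; congr (_ * mmap1 z _).
    by apply: eq_bigr => i _; rewrite odd_f.
  apply/mnmP => i; rewrite mnmDE !(half_mnmE) !mnmDE addnn halfD odd_double andbF add0n.
  by rewrite doubleK.
have <- : mdeg f = (mdeg e).+2 by rewrite !mdegD mdeg1 addn2.
by apply/span_on_mon/odd_inP => i /(odd_inP _ _ oe); rewrite odd_f.
Qed.

Let span_on_lspanM s d w u : lspan z w -> span_on s d u -> span_on s d.+2 (w * u).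
Proof.
move=> [c ->] hu; rewrite mulr_suml; elim/big_ind: _ => [|? ?|k _].
- exact: span_on0.
- exact: span_onD.
- by rewrite -scalerAl; apply/span_onZ/span_on_zM.
Qed.

Let span_on_cons j s d u : j \notin s -> span_on s d u -> span_on (j :: s) d u.
Proof.
move=> js; move: u; apply: span_on_ind => [|u v|c u|e <- /odd_inP oe].
- exact: span_on0.
- exact: span_onD.
- exact: span_onZ.
have -> : partial_mon s e = partial_mon (j :: s) e.
  by rewrite /partial_mon big_cons (negPf (oe _ js)) mul1r.
by apply/span_on_mon/odd_inP => i; rewrite inE negb_or => /andP [_ /oe].
Qed.

Let span_on_head j s d u : j \notin s -> span_on s d u -> span_on (j :: s) d.+1 (a j * u).
Proof.
move=> js; move: u; apply: span_on_ind => [|u v|c u|e <- /odd_inP oe].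
- by rewrite mulr0.
- by rewrite mulrDr; apply: span_onD.
- by rewrite -scalerAr; apply: span_onZ.
pose f := (e + U_(j))%MM.
have fE i : f i = (e i + (j == i))%N by rewrite mnmDE mnm1E.
have ej := oe _ js.
have -> : a j * partial_mon s e = partial_mon (j :: s) f.
  rewrite /partial_mon big_cons fE eqxx addn1 /= ej mulrA; congr (_ * _ * mmap1 z _).
    apply: eq_big_seq => i si; rewrite fE; case: eqP => [ji|_]; last by rewrite addn0.
    by rewrite ji si in js.
  apply/mnmP => i; rewrite !half_mnmE fE; case: eqP => [<-|_]; rewrite ?addn0 //.
  by rewrite addn1 /= uphalf_half (negPf ej).
have <- : mdeg f = (mdeg e).+1 by rewrite mdegD mdeg1 addn1.
apply/span_on_mon/odd_inP => i; rewrite inE negb_or fE => /andP [].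
by rewrite eq_sym => /negPf ->; rewrite addn0; apply: oe.
Qed.

(** The monomials split according to the parity of the exponent of [j], that is
    according to whether the leading factor [a j] is present. *)
Let span_on_cons_ind j s d (P : B -> Prop) : j \notin s ->
  P 0 -> (forall u v, P u -> P v -> P (u + v)) -> (forall c u, P u -> P (c *: u)) ->
  (forall u, span_on s d u -> P u) ->
  (forall d' u, d = d'.+1 -> span_on s d' u -> P (a j * u)) ->
  forall u, span_on (j :: s) d u -> P u.
Proof.
move=> js P0 PD PZ Ps Pj; apply: span_on_ind => // e de /odd_inP oe.
case: (boolP (odd (e j))) => ej; last first.
  apply: Ps; rewrite -de; have -> : partial_mon (j :: s) e = partial_mon s e.
    by rewrite /partial_mon big_cons (negPf ej) mul1r.
  apply/span_on_mon/odd_inP => i si; have [->//|ij] := eqVneq i j.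
  by apply: oe; rewrite inE negb_or ij.
pose f := (e - U_(j))%MM.
have fE i : f i = (e i - (j == i))%N by rewrite mnmBE mnm1E.
have ej0 : (0 < e j)%N by case: (e j) ej.
have de' : d = (mdeg f).+1.
  rewrite -de -[X in mdeg X](@submK _ U_(j)%MM); first by rewrite mdegD mdeg1 addn1.
  by rewrite lep1mP -lt0n.
have -> : partial_mon (j :: s) e = a j * partial_mon s f.
  rewrite /partial_mon big_cons ej mulrA; congr (_ * _ * mmap1 z _).
    apply: eq_big_seq => i si; rewrite fE; case: eqP => [ji|_]; last by rewrite subn0.
    by rewrite ji si in js.
  apply/mnmP => i; rewrite !half_mnmE fE; case: eqP => [<-|_]; rewrite ?subn0 //.
  by rewrite subn1; case: (e j) ej => //= k; rewrite uphalf_half => /negPf ->.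
apply: (Pj _ _ de'); apply/span_on_mon/odd_inP => i si; rewrite fE.
have [<-|ij] := eqVneq j i; first by rewrite subn1; case: (e j) ej ej0.
by rewrite subn0 oe // inE negb_or eq_sym ij.
Qed.

(** For [i = j] the product [a j a j] lies in the span of the [z k], which acts
    on both halves of the splitting; otherwise [a i] is moved past [a j] by the
    anticommutation rule and the induction hypothesis applies. *)
Let span_on_aM s : uniq s -> forall i d u, i \in s -> span_on s d u -> span_on s d.+1 (a i * u).
Proof.
elim: s => //= j s IH /andP [js us] i d u + Hu.
have sq : lspan z (a j * a j).
  have -> : a j * a j = 2%:R^-1 *: (a j * a j + a j * a j).
    by rewrite -mulr2n -scaler_nat scalerA mulVf // scale1r.
  exact/lspanZ/anticomm.
have [->|ij] := eqVneq i j.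
  move=> _; move: u Hu; apply: span_on_cons_ind => // [|u v|c u|u|d' u -> hu].
  - by rewrite mulr0.
  - by rewrite mulrDr; apply: span_onD.
  - by rewrite -scalerAr; apply: span_onZ.
  - exact: span_on_head.
  - by rewrite mulrA; apply/span_on_cons/span_on_lspanM.
rewrite inE (negPf ij) /= => si.
move: u Hu; apply: span_on_cons_ind => // [|u v|c u|u hu|d' u -> hu].
- by rewrite mulr0.
- by rewrite mulrDr; apply: span_onD.
- by rewrite -scalerAr; apply: span_onZ.
- exact/span_on_cons/IH.
rewrite mulrA -[a i * a j](addrK (a j * a i)) mulrBl.
apply: span_onD; first by apply/span_on_cons/span_on_lspanM.
rewrite -mulrA -scaleN1r; apply/span_onZ/span_on_head => //; exact: IH.
Qed.

Let gr_span_on d u : gr d u -> span_on (index_enum 'I_n) d u.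
Proof.
move: d u; apply: hcomp_min => [d|d u v|d c u||d [i|k] u hu].
- exact: span_on0.
- exact: span_onD.
- exact: span_onZ.
- have <- : partial_mon (index_enum 'I_n) 0%MM = 1.
    rewrite /partial_mon big1 => [|i _]; last by rewrite mnm0E.
    rewrite mul1r (_ : half_mnm _ = 0%MM) ?mmap11 //.
    by apply/mnmP => i; rewrite !mnmE.
  by rewrite -{1}(@mdeg0 n); apply/span_on_mon/odd_inP => i _; rewrite mnm0E.
- by apply: span_on_aM; rewrite ?index_enum_uniq ?mem_index_enum.
- exact: span_on_zM.
Qed.

Lemma clifford_mon_homog e : gr (mdeg e) (clifford_mon e).
Proof.
have gra i : gr 1%N (a i) by apply: (@hcomp_gen _ _ _ _ (cgen a z) (inl i)).
have grz i : gr 2%N (z i) by apply: (@hcomp_gen _ _ _ _ (cgen a z) (inr i)).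
have grX d u k : gr d u -> gr (k * d)%N (u ^+ k).
  move=> h; elim: k => [|k IH]; first exact: hcomp1.
  by rewrite exprS mulSn; apply: hcompM.
have grP (F : 'I_n -> nat) (G : 'I_n -> B) s :
    (forall i, gr (F i) (G i)) -> gr (\sum_(i <- s) F i)%N (\prod_(i <- s) G i).
  move=> h; elim: s => [|i s IH]; rewrite ?big_nil ?big_cons; first exact: hcomp1.
  exact: hcompM.
have -> : mdeg e = (\sum_i odd (e i) * 1 + \sum_i half_mnm e i * 2)%N.
  rewrite mdegE -big_split; apply: eq_bigr => i _ /=.
  by rewrite mnmE muln1 muln2 odd_double_half.
by apply: hcompM; apply: grP => i; apply: grX.
Qed.

(** The ordered monomials of degree [d] span degree [d] by straightening, and
    there are as many of them as the dimension of that component, since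
    [(1 + t)^n / (1 - t^2)^n = 1 / (1 - t)^n]; so they are independent. *)
Lemma clifford_mon_free :
  (forall d, has_dim *:%R (gr d) 'C((n + d).-1, d)%N) -> independent_grading gr ->
  forall p : {mpoly K[n]}, lext clifford_mon p = 0 -> p = 0.
Proof.
move=> dims indep p p0; apply/mpolyP => m; rewrite mcoeff0.
pose d := mdeg m; pose b := [seq s2m t | t : d.-tuple 'I_n <- enum (basis n d)].
have szb : size b = 'C((n + d).-1, d) by apply: size_monomials.
pose v (i : 'I_('C((n + d).-1, d))) := clifford_mon (nth 0%MM b i).
have mem_b k : (k \in b) = (mdeg k == d) by rewrite basis_cover.
have deg_nth i : (i < 'C((n + d).-1, d))%N -> mdeg (nth 0%MM b i) = d.
  by move=> h; apply/eqP; rewrite -mem_b mem_nth ?szb.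
have v_homog i : gr d (v i) by rewrite -[d in gr d](deg_nth i) //; apply: clifford_mon_homog.
have v_span u : gr d u -> lspan v u.
  move/gr_span_on; move: u; apply: span_on_ind => [|? ?|? ?|e ed _]; first exact: lspan0.
  - exact: lspanD.
  - exact: lspanZ.
  have lt_e : (index e b < 'C((n + d).-1, d))%N by rewrite -szb index_mem mem_b ed.
  suff -> : partial_mon (index_enum 'I_n) e = v (Ordinal lt_e) by apply: lspan_gen.
  by rewrite /v nth_index // mem_b ed.
have free_v := spanning_free (dims d) v_homog v_span.
have pd0 : \sum_(k <- msupp p | mdeg k == d) p@_k *: clifford_mon k = 0.
  by apply: (indep _ (msupp p) _ _ _ p0) => k; apply/hcompZ/clifford_mon_homog.
pose pd : {mpoly K[n]} := \sum_(k <- msupp p | mdeg k == d) p@_k *: 'X_[k].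
have pdE k : pd@_k = if mdeg k == d then p@_k else 0.
  rewrite mcoeff_sumX ?msupp_uniq // mcoeff_msupp.
  by case: eqVneq => [->|//]; case: ifP.
have : lext clifford_mon pd = 0.
  rewrite -pd0 linear_sum; apply: eq_bigr => k _.
  by rewrite linearZ /= lextX.
rewrite (@lext_big _ _ _ _ b) ?uniq_basis // => [|k]; last first.
  by rewrite mcoeff_msupp pdE mem_b; case: (mdeg k =P d); rewrite ?eqxx.
rewrite (big_nth 0%MM) szb big_mkord => /free_v h.
have lt_m : (index m b < 'C((n + d).-1, d))%N by rewrite -szb index_mem mem_b.
by have := h (Ordinal lt_m); rewrite /= nth_index ?mem_b // pdE eqxx.
Qed.

End CliffordMonomials.

Lemma sorted_enum_ord n : sorted (fun i j : 'I_n => i < j)%N (index_enum 'I_n).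
Proof.
rewrite [index_enum _](_ : _ = enum 'I_n); last by rewrite enumT /index_enum; unlock.
by have := iota_ltn_sorted 0 n; rewrite -val_enum_ord sorted_map.
Qed.

Section FreeClifford.
Variables (K : fieldType) (n : nat) (B : algType K) (a z : 'I_n -> B).
Hypothesis two_neq0 : 2%:R != 0 :> K.
Hypothesis z_central : forall k u, z k * u = u * z k.
Hypothesis anticomm : forall i j, lspan z (a i * a j + a j * a i).
Hypothesis mon_free : forall p : {mpoly K[n]}, lext (clifford_mon a z) p = 0 -> p = 0.

Lemma clifford_mon_even m : clifford_mon a z (m + m) = mmap1 z m.
Proof.
rewrite /clifford_mon big1 => [|i _]; last by rewrite mnmDE addnn odd_double.
rewrite mul1r; congr mmap1; apply/mnmP => i.
by rewrite half_mnmE mnmDE addnn doubleK.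
Qed.

Lemma clifford_mon_pair (i j : 'I_n) : (i < j)%N ->
  clifford_mon a z (U_(i) + U_(j)) = a i * a j.
Proof.
move=> ij; have nij : i != j by rewrite neq_ltn ij.
rewrite /clifford_mon (_ : half_mnm _ = 0%MM) ?mmap11 ?mulr1; last first.
  apply/mnmP => k; rewrite half_mnmE mnmDE !mnm1E mnm0E.
  by case: (i =P k) => [<-|_]; [rewrite eq_sym (negPf nij) | case: eqP].
have expE k : odd ((U_(i) + U_(j))%MM k) = (i == k) || (j == k) :> nat.
  rewrite mnmDE !mnm1E; case: eqP => [<-|_]; first by rewrite eq_sym (negPf nij).
  by case: eqP.
under eq_bigr do rewrite expE.
have single (s : seq 'I_n) : uniq s -> j \in s -> i \notin s ->
    \prod_(k <- s) a k ^+ ((i == k) || (j == k)) = a j.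
  elim: s => //= k s IH /andP [ks us]; rewrite !inE !negb_or big_cons.
  have [jk|jk] /= := eqVneq j k.
    subst k => _ /andP [/negPf -> is']; rewrite big_seq big1 ?mulr1 // => l ls.
    case: eqP => [il|_]; first by rewrite il ls in is'.
    by case: eqP => [jl|_] //; rewrite jl ls in ks.
  by move=> js /andP [/negPf -> is']; rewrite mul1r IH.
have := mem_index_enum j; have := mem_index_enum i; have := sorted_enum_ord n.
have := index_enum_uniq 'I_n.
elim: (index_enum 'I_n) => //= k s IH /andP [ks us] hs.
have ltk (l : 'I_n) : l \in s -> (k < l)%N.
  move: l; apply/allP; apply: order_path_min hs.
  by move=> ? ? ?; apply: ltn_trans.
rewrite !inE big_cons; case: (eqVneq i k) => [ik|ik] /=.
  subst k => _; rewrite eq_sym (negPf nij) /= => js.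
  by rewrite single.
have [jk|_] /= := eqVneq j k; last by move=> ? ?; rewrite mul1r IH ?(path_sorted hs).
by move=> /ltk; rewrite -jk => /(ltn_trans ij); rewrite ltnn.
Qed.

Let square_in i : lspan z (a i * a i).
Proof.
have -> : a i * a i = 2%:R^-1 *: (a i * a i + a i * a i).
  by rewrite -mulr2n -scaler_nat scalerA mulVf // scale1r.
exact/lspanZ/anticomm.
Qed.

(** In terms of exponents [2 U(k)] the elements of the span have no coefficient
    at a product of two distinct variables. *)
Let lspan_poly w : lspan z w -> exists2 p : {mpoly K[n]}, lext (clifford_mon a z) p = w &
  forall i j : 'I_n, (i < j)%N -> p@_(U_(i) + U_(j)) = 0.
Proof.
move=> [c ->]; exists (\sum_k c k *: 'X_[U_(k) + U_(k)]).
  rewrite linear_sum; apply: eq_bigr => k _.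
  by rewrite linearZ /= lextX clifford_mon_even mmap1U.
move=> i j ij; rewrite raddf_sum big1 // => k _ /=; rewrite mcoeffZ mcoeffX.
case: eqP => [/mnmP e|_]; last by rewrite mulr0.
have := e j; have := e i; rewrite !mnmDE !mnm1E !eqxx.
have -> : (i == j) = false by apply/negbTE; rewrite neq_ltn ij.
have -> : (j == i) = false by apply/negbTE; rewrite neq_ltn ij orbT.
by case: eqP.
Qed.

(** Modulo the span of the [z k], the product [a i a j] is [- a j a i] and the
    squares vanish, while the [a i a j] with [i < j] stay independent: degree two
    looks like that of an exterior algebra. *)
Lemma symmetric_coefficients (c : 'I_n -> 'I_n -> K) :
  lspan z (\sum_i \sum_j c i j *: (a i * a j)) -> forall i j, c i j = c j i.
Proof.
pose pairX i j : {mpoly K[n]} := 'X_[U_(i) + U_(j)].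
(* [sg i j p q] is the coefficient at [U(i) + U(j)] of the straightened form of
   [a p a q]. *)
pose sg (i j p q : 'I_n) : K := ((p == i) && (q == j))%:R - ((p == j) && (q == i))%:R.
have pairXE (i j p q : 'I_n) : (i < j)%N -> (p < q)%N ->
    (pairX p q)@_(U_(i) + U_(j)) = ((p == i) && (q == j))%:R.
  move=> ij pq; rewrite mcoeffX; congr (_ %:R); congr nat_of_bool; apply/eqP/andP.
    have ij0 : (i == j) = false by apply/negbTE; rewrite neq_ltn ij.
    have ji0 : (j == i) = false by apply/negbTE; rewrite neq_ltn ij orbT.
    move=> /mnmP e; have := e i; have := e j; rewrite !mnmDE !mnm1E !eqxx ij0 ji0.
    case: (p =P i) => [->|_]; first by rewrite ij0; case: eqP.
    case: (q =P i) => [qi|_] //; rewrite qi ij0.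
    by case: (p =P j) => [pj|_] //; move: pq; rewrite qi pj ltnNge ltnW.
  by move=> [/eqP -> /eqP ->].
have str p q : exists2 T : {mpoly K[n]}, lext (clifford_mon a z) T = a p * a q &
    forall i j : 'I_n, (i < j)%N -> T@_(U_(i) + U_(j)) = sg i j p q.
  case: (ltngtP p q) => pq.
  - exists (pairX p q); first by rewrite lextX clifford_mon_pair.
    move=> i j ij; rewrite pairXE // /sg [X in _ - X](_ : _ = 0) ?subr0 //.
    by case: (p =P j) => [pj|//]; case: (q =P i) pq => [->|//]; rewrite pj ltnNge ltnW.
  - have [T TE T0] := lspan_poly (anticomm p q).
    exists (T - pairX q p).
      by rewrite linearB /= TE lextX clifford_mon_pair // addrK.
    move=> i j ij; rewrite mcoeffB T0 // pairXE // /sg sub0r [X in X - _](_ : _ = 0).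
      by rewrite sub0r andbC.
    by case: (p =P i) => [pi|//]; case: (q =P j) pq => [->|//]; rewrite pi ltnNge ltnW.
  - have e : p = q by apply: val_inj.
    have [T TE T0] := lspan_poly (square_in p).
    exists T; first by rewrite TE e.
    by move=> i j ij; rewrite T0 // /sg e andbC subrr.
have [T TE Tsg] := fin_all_exists2 (fun p => fin_all_exists2 (str p)).
move=> /lspan_poly [R RE R0].
have e : R = \sum_p \sum_q c p q *: T p q.
  apply/eqP; rewrite -subr_eq0; apply/eqP/mon_free; rewrite linearB /= RE.
  apply/eqP; rewrite subr_eq0; apply/eqP; rewrite linear_sum; apply: eq_bigr => p _.
  rewrite linear_sum; apply: eq_bigr => q _.
  by rewrite linearZ /= TE.
have main (i j : 'I_n) : (i < j)%N -> c i j = c j i.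
  move=> ij; have nij : i != j by rewrite neq_ltn ij.
  apply/eqP; rewrite -subr_eq0 -(R0 i j ij) e raddf_sum /=; apply/eqP.
  under eq_bigr do rewrite raddf_sum /=.
  under eq_bigr do under eq_bigr => q _ do rewrite mcoeffZ Tsg //.
  have pick (x y : 'I_n) : \sum_p \sum_q c p q * ((p == x) && (q == y))%:R = c x y.
    rewrite (bigD1 x) //= (bigD1 y) //= !eqxx mulr1 !big1 ?addr0 //.
      by move=> p /negPf ->; rewrite big1 // => q _; rewrite mulr0.
    by move=> q /negPf ->; rewrite mulr0.
  rewrite -{1}(pick i j) -(pick j i) -sumrB; apply: eq_bigr => p _.
  by rewrite -sumrB; apply: eq_bigr => q _; rewrite mulrBr.
move=> i j; case: (ltngtP i j) => [/main //|/main //|/val_inj -> //].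
Qed.

Lemma free_even (p : {mpoly K[n]}) : lext (mmap1 z) p = 0 -> p = 0.
Proof.
have dbl_inj (m k : 'X_{1..n}) : ((m + m)%MM == (k + k)%MM) = (m == k).
  apply/eqP/eqP => [/mnmP e|->//]; apply/mnmP => i.
  by have := e i; rewrite !mnmDE !addnn => /double_inj.
(* Doubling exponents turns a monomial in the [z k] into an even ordered one. *)
pose q : {mpoly K[n]} := lext (fun m => 'X_[m + m]) p.
have <- : lext (clifford_mon a z) q = lext (mmap1 z) p.
  rewrite /q /lext -/(lext _ _) linear_sum; apply: eq_bigr => m _.
  by rewrite linearZ /= lextX clifford_mon_even.
move=> /mon_free q0; apply/mpolyP => m; rewrite mcoeff0.
case: (boolP (m \in msupp p)) => [ms|/memN_msupp_eq0 //].
have := congr1 (mcoeff (m + m)%MM) q0; rewrite mcoeff0 raddf_sum /=.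
rewrite (big_rem m) //= mcoeffZ mcoeffX eqxx mulr1 [X in _ + X]big_seq [X in _ + X]big1 ?addr0 //.
move=> k; rewrite mem_rem_uniq ?msupp_uniq // => /andP [/= /negPf km _].
by rewrite mcoeffZ mcoeffX dbl_inj km mulr0.
Qed.

Lemma free_generators (c : 'I_n -> K) : \sum_i c i *: z i = 0 -> forall i, c i = 0.
Proof.
move=> c0; pose p : {mpoly K[n]} := \sum_i c i *: 'X_i.
have p0 : p = 0.
  apply: free_even; rewrite -[RHS]c0 linear_sum; apply: eq_bigr => i _.
  by rewrite linearZ /= lextX mmap1U.
move=> i; have := congr1 (mcoeff U_(i)%MM) p0; rewrite mcoeff0 raddf_sum /=.
rewrite (bigD1 i) //= mcoeffZ mcoeffX eqxx mulr1 big1 ?addr0 // => j /negPf ji.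
by rewrite mcoeffZ mcoeffX eq_mnm1 ji mulr0.
Qed.

End FreeClifford.

(** * Skew polynomial rings from free ordered monomials *)

Section SkewMonomials.
Variables (K : fieldType) (n : nat) (Q : 'I_n -> 'I_n -> K).
Hypothesis Q_neq0 : forall i j, Q i j != 0.

Definition descents_commute (D : algType K) (d : 'I_n -> D) : Prop :=
  forall i j : 'I_n, (j < i)%N -> d i * d j = Q i j *: (d j * d i).

Lemma gen_mul_prod (D : algType K) (d : 'I_n -> D) (m : 'I_n -> nat) i (s : seq 'I_n) :
  descents_commute d -> sorted (fun i j : 'I_n => i < j)%N s -> i \in s ->
  d i * \prod_(j <- s) d j ^+ m j =
  (\prod_(j <- s | (j < i)%N) Q i j ^+ m j) *: \prod_(j <- s) d j ^+ (m j + (i == j)).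
Proof.
move=> hd; elim: s => //= j s IH hs.
have tr : transitive (fun i j : 'I_n => i < j)%N by move=> ? ? ?; apply: ltn_trans.
have js (k : 'I_n) : k \in s -> (j < k)%N.
  by move: k; apply/allP; exact: order_path_min tr hs.
rewrite inE !big_cons; have [->|ij] /= := eqVneq i j.
  move=> _; rewrite ltnn ?eqxx addn1 mulrA -exprS.
  rewrite [\prod_(k <- s | (k < j)%N) _]big_seq_cond.
  rewrite [\prod_(k <- s | _ && _) _]big1 ?scale1r; last first.
    by move=> k /andP [/js jk kj]; move: (ltn_trans jk kj); rewrite ltnn.
  congr (_ * _); apply: eq_big_seq => k /js.
  by case: eqP => [<-|_]; rewrite ?ltnn // addn0.
move=> si; rewrite (js _ si) addn0.
have -> : forall u : D, d i * (d j ^+ m j * u) = Q i j ^+ m j *: (d j ^+ m j * (d i * u)).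
  move=> u; elim: (m j) u => [|k IHk] u; first by rewrite !expr0 !mul1r scale1r.
  rewrite exprSr -mulrA IHk [d i * (_ * _)]mulrA hd ?js //.
  by rewrite -scalerAl -scalerAr scalerA -exprSr exprSr !mulrA.
by rewrite IH ?(path_sorted hs) // -scalerAr scalerA.
Qed.

(** Straightening a product of two ordered monomials only uses the commutation
    rules, so it costs the same nonzero scalar in every algebra where they
    hold. *)
Lemma monomial_cocycle : exists chi : 'X_{1..n} -> 'X_{1..n} -> K,
  (forall m m', chi m m' != 0) /\
  forall (D : algType K) (d : 'I_n -> D), descents_commute d ->
    forall m m', mmap1 d m * mmap1 d m' = chi m m' *: mmap1 d (m + m').
Proof.
pose straight m m' c := c != 0 /\ forall (D : algType K) (d : 'I_n -> D),
    descents_commute d -> mmap1 d m * mmap1 d m' = c *: mmap1 d (m + m').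
suff ex m m' : exists c, straight m m' c.
  have [chi hchi] := boolp.choice (fun t : _ * _ => ex t.1 t.2).
  exists (fun m m' => chi (m, m')); split; first by move=> m m'; case: (hchi (m, m')).
  by move=> D d hd m m'; case: (hchi (m, m')) => _; apply.
have step i m0 : exists2 c, c != 0 & forall (D : algType K) (d : 'I_n -> D),
    descents_commute d -> d i * mmap1 d m0 = c *: mmap1 d (U_(i) + m0)%MM.
  exists (\prod_(j < n | (j < i)%N) Q i j ^+ m0 j).
    by apply/prodf_neq0 => j _; apply: expf_neq0.
  move=> D d hd; rewrite /mmap1 gen_mul_prod ?sorted_enum_ord ?mem_index_enum //.
  by congr (_ *: _); apply: eq_bigr => j _; rewrite mnmDE mnm1E addnC.
have step_exp i k m0 : exists2 c, c != 0 & forall (D : algType K) (d : 'I_n -> D),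
    descents_commute d -> d i ^+ k * mmap1 d m0 = c *: mmap1 d (U_(i) *+ k + m0)%MM.
  elim: k => [|k [c c0 IH]]; first exists 1; rewrite ?oner_eq0 //.
    by move=> D d _; rewrite mul1r scale1r mulm0n add0m.
  have [c' c'0 h] := step i (U_(i) *+ k + m0)%MM.
  exists (c * c'); first by rewrite mulf_neq0.
  by move=> D d hd; rewrite exprS -mulrA IH // -scalerAr h // scalerA addmA -mulmS.
have step_prod (s : seq 'I_n) m0 : exists2 c, c != 0 &
    forall (D : algType K) (d : 'I_n -> D), descents_commute d ->
    \prod_(i <- s) d i ^+ m i * mmap1 d m0 =
      c *: mmap1 d (\sum_(i <- s) U_(i) *+ m i + m0)%MM.
  elim: s => [|i s [c c0 IH]]; first exists 1; rewrite ?oner_eq0 //.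
    by move=> D d _; rewrite !big_nil mul1r scale1r add0m.
  have [c' c'0 h] := step_exp i (m i) (\sum_(i <- s) U_(i) *+ m i + m0)%MM.
  exists (c * c'); first by rewrite mulf_neq0.
  move=> D d hd; rewrite !big_cons -mulrA IH // -scalerAr h // scalerA.
  by rewrite [in LHS]addmA.
have [c c0 h] := step_prod (index_enum 'I_n) m'.
exists c; split=> // D d hd; rewrite [X in X * _]/mmap1 h //.
by rewrite -multinomUE_id.
Qed.

Section Free.
Variables (S : algType K) (z : 'I_n -> S).
Hypothesis z_comm : forall i j, z i * z j = Q i j *: (z j * z i).
Hypothesis z_gen : forall u, exists p, u = nceval z p.
Hypothesis z_free : forall p : {mpoly K[n]}, lext (mmap1 z) p = 0 -> p = 0.

Let chi_spec := monomial_cocycle.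

(** Commuting polynomials model every algebra satisfying the commutation rules
    once their product is deformed by the cocycle. *)
Let star (chi : 'X_{1..n} -> 'X_{1..n} -> K) (p q : {mpoly K[n]}) : {mpoly K[n]} :=
  \sum_(m <- msupp p) \sum_(m' <- msupp q) (p@_m * q@_m' * chi m m') *: 'X_[m + m'].

Let star_ev chi (D : algType K) (d : 'I_n -> D) p q :
  (forall m m', mmap1 d m * mmap1 d m' = chi m m' *: mmap1 d (m + m')%MM) ->
  lext (mmap1 d) (star chi p q) = lext (mmap1 d) p * lext (mmap1 d) q.
Proof.
move=> h; rewrite linear_sum mulr_suml; apply: eq_bigr => m _.
rewrite linear_sum mulr_sumr; apply: eq_bigr => m' _.
by rewrite linearZ /= lextX -scalerAl -scalerAr h !scalerA.
Qed.

Let ev_inj : injective (lext (mmap1 z)).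
Proof.
move=> p q e; apply/eqP; rewrite -subr_eq0; apply/eqP/z_free.
by rewrite linearB /= e subrr.
Qed.

Let z_desc : descents_commute z.
Proof. by move=> i j _; apply: z_comm. Qed.

Let ev_surj u : exists p, lext (mmap1 z) p = u.
Proof.
have [chi [_ hchi]] := chi_spec.
have [w ->] := z_gen u.
apply: (@nceval_ind _ _ _ z (fun u => exists p, lext (mmap1 z) p = u)).
- by exists 'X_[0]; rewrite lextX mmap11.
- by move=> ? ? [p <-] [q <-]; exists (p + q); rewrite linearD.
- by move=> c ? [p <-]; exists (c *: p); rewrite linearZ.
- move=> i ? [p <-]; exists (star chi 'X_i p).
  by rewrite star_ev; [rewrite lextX mmap1U | exact: hchi z_desc].
Qed.

(** Only the pair of leading monomials contributes to the coefficient at their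
    sum, and the cocycle does not vanish there. *)
Let star_neq0 chi p q : (forall m m', chi m m' != 0) ->
  p != 0 -> q != 0 -> star chi p q != 0.
Proof.
move=> chi0 p0 q0; pose M := (mlead p + mlead q)%MM.
suff : (star chi p q)@_M != 0 by apply: contra => /eqP ->; rewrite mcoeff0.
have only m m' : m \in msupp p -> m' \in msupp q -> (m + m')%MM = M ->
    m = mlead p /\ m' = mlead q.
  move=> /msupp_le_mlead hm /msupp_le_mlead hm' e.
  have em : m = mlead p.
    apply/eqP; move: hm; rewrite le_eqVlt => /orP [//|hlt].
    by have := ltmc_le_add hlt hm'; rewrite e ltxx.
  by split=> //; apply: (@addmI _ (mlead p)); rewrite -{1}em.
rewrite raddf_sum (big_rem (mlead p)) ?mlead_supp //=.
rewrite [X in _ + X]big_seq [X in _ + X]big1; last first.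
  move=> m; rewrite mem_rem_uniq ?msupp_uniq // => /andP [/= np hm].
  rewrite raddf_sum big_seq big1 // => m' hm'.
  rewrite /= mcoeffZ mcoeffX; case: eqP => [/(only _ _ hm hm') [e _]|_]; last by rewrite mulr0.
  by rewrite e eqxx in np.
rewrite addr0 raddf_sum /= (big_rem (mlead q)) ?mlead_supp //=.
rewrite [X in _ + X]big_seq [X in _ + X]big1; last first.
  move=> m'; rewrite mem_rem_uniq ?msupp_uniq // => /andP [/= nq hm'].
  rewrite /= mcoeffZ mcoeffX; case: eqP => [/(only _ _ (mlead_supp p0) hm') [_ e]|_].
    by rewrite e eqxx in nq.
  by rewrite mulr0.
by rewrite addr0 /= mcoeffZ mcoeffX eqxx mulr1 !mulf_neq0 ?mleadc_eq0.
Qed.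

Let skew_rel_desc (D : algType K) (d : 'I_n -> D) :
  descents_commute d <->
  (forall p, p \in skew_rels (fun i j => Q j i) -> nceval d p = 0).
Proof.
have relE i j : nceval d [:: (1, [:: i; j]); (- Q i j, [:: j; i])] =
    d i * d j - Q i j *: (d j * d i).
  by rewrite /nceval !big_cons !big_nil !mulr1 scale1r addr0 scaleNr.
split=> [hd p /mapP [[i j]]|h i j ji].
  by rewrite mem_enum => /= ij ->; rewrite relE hd // subrr.
apply/eqP; rewrite -subr_eq0 -relE; apply/eqP/h/mapP.
by exists (j, i) => //; rewrite mem_enum.
Qed.

Let ev_morph (D : algType K) (d : 'I_n -> D) : descents_commute d ->
  exists f : {lrmorphism S -> D}, forall i, f (z i) = d i.
Proof.
move=> hd; have [chi [_ hchi]] := chi_spec.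
(* On ordered monomials the morphism is forced, so it is the evaluation at [d]
   transported along the bijective evaluation at [z]. *)
have [g gK] := boolp.choice ev_surj.
pose f0 u := lext (mmap1 d) (g u).
have f0E p : f0 (lext (mmap1 z) p) = lext (mmap1 d) p.
  by congr (lext _ _); apply: ev_inj.
have lin : linear f0.
  move=> c u v; rewrite -(gK u) -(gK v) -linearP !f0E; exact: linearP.
have mul : monoid_morphism f0.
  split; first by rewrite -(mmap11 z) -lextX f0E lextX mmap11.
  move=> u v; rewrite -(gK u) -(gK v) -(star_ev _ _ (hchi _ _ z_desc)) !f0E.
  by apply: star_ev; apply: hchi.
pose f : {lrmorphism S -> D} := HB.pack f0
  (GRing.isLinear.Build K S D _ f0 lin) (GRing.isMonoidMorphism.Build S D f0 mul).
exists f => i; rewrite -[f _]/(f0 _).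
by rewrite -(mmap1U z) -lextX f0E lextX mmap1U.
Qed.

(** Evaluation at [z] is a bijection turning the deformed product of polynomials
    into the product of [S].  Leading monomials make the deformed product a
    domain, and since the deformation depends on the commutation rules alone,
    evaluation in any other algebra obeying them factors through [S]. *)
Lemma skew_polynomial_of_free : skew_polynomial z.
Proof.
split.
- have [chi [chi0 hchi]] := chi_spec.
  move=> u v; have [p <-] := ev_surj u; have [q <-] := ev_surj v.
  rewrite -(star_ev _ _ (hchi _ _ z_desc)) => /z_free pq0.
  have [->|p0] := eqVneq p 0; first by left; rewrite linear0.
  have [->|q0] := eqVneq q 0; first by right; rewrite linear0.
  by move: (star_neq0 chi0 p0 q0); rewrite pq0 eqxx.
- exists (fun i j => Q j i); split=> // ; split=> //; first exact/skew_rel_desc.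
  by move=> D d /skew_rel_desc/ev_morph.
- have ind := @nceval_ind _ _ _ z.
  move=> k; split=> u; have [p ->] := z_gen u.
    apply: (ind (fun u => exists f, z k * u = f * z k)).
    - by exists 1; rewrite mulr1 mul1r.
    - by move=> v w [f fE] [g gE]; exists (f + g); rewrite mulrDr mulrDl fE gE.
    - by move=> c v [f fE]; exists (c *: f); rewrite -scalerAr -scalerAl fE.
    - move=> i v [f fE]; exists (Q k i *: (z i * f)).
      by rewrite mulrA z_comm -!scalerAl -!mulrA fE.
  apply: (ind (fun u => exists f, u * z k = z k * f)).
  - by exists 1; rewrite mulr1 mul1r.
  - by move=> v w [f fE] [g gE]; exists (f + g); rewrite mulrDr mulrDl fE gE.
  - by move=> c v [f fE]; exists (c *: f); rewrite -scalerAr -scalerAl fE.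
  - move=> i v [f fE]; exists (Q i k *: (z i * f)).
    by rewrite -mulrA fE mulrA z_comm -!scalerAl -scalerAr mulrA.
Qed.

End Free.
End SkewMonomials.

(** * The inclusion of a subalgebra *)

Section SubalgVal.
Variables (K : fieldType) (I : Type) (A : algType K) (a : I -> A).
Implicit Types u v : subalg a.

Lemma subalg_val0 : val (0 : subalg a) = 0. Proof. exact: rmorph0. Qed.
Lemma subalg_val1 : val (1 : subalg a) = 1. Proof. exact: rmorph1. Qed.
Lemma subalg_valD u v : val (u + v) = val u + val v. Proof. exact: rmorphD. Qed.
Lemma subalg_valM u v : val (u * v) = val u * val v. Proof. exact: rmorphM. Qed.
Lemma subalg_valZ c u : val (c *: u) = c *: val u. Proof. exact: linearZ. Qed.

Lemma subalg_val_sum T (s : seq T) (F : T -> subalg a) :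
  val (\sum_(t <- s) F t) = \sum_(t <- s) val (F t).
Proof. exact: linear_sum. Qed.

Lemma subalg_val_prod T (s : seq T) (F : T -> subalg a) :
  val (\prod_(t <- s) F t) = \prod_(t <- s) val (F t).
Proof. exact: rmorph_prod. Qed.

Lemma subalg_valX u k : val (u ^+ k) = val u ^+ k. Proof. exact: rmorphXn. Qed.

End SubalgVal.

(** * Twists and eigenvectors *)

Section TwistedMonomials.
Variables (K : fieldType) (I : Type) (A B : algType K) (wt : I -> nat) (g : I -> B).
Variables (gr' : nat -> A -> Prop) (tau : {lrmorphism B -> B}) (theta : {linear B -> A}).
Notation gr := (hcomp wt g).
Hypothesis g_gen : forall u, exists p, u = nceval g p.
Hypothesis twist : twist_via gr gr' tau theta.

Lemma iter_tau_linear i c u v :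
  iter i tau (c *: u + v) = c *: iter i tau u + iter i tau v.
Proof. by elim: i => //= i ->; rewrite linearP. Qed.

Lemma iter_tauD i u v : iter i tau (u + v) = iter i tau u + iter i tau v.
Proof. by rewrite -[u]scale1r iter_tau_linear !scale1r. Qed.

(** Both sides are additive in [b] and [B] is spanned by homogeneous elements, so
    the rule for a twist extends to every right factor. *)
Lemma twist_mul i a b : gr i a -> theta a * theta b = theta (a * iter i tau b).
Proof.
case: twist => _ _ tw ha; move: b; apply: (homog_ind (wt := wt) g_gen) => [|u v hu hv|d u hu].
- have -> : iter i tau 0 = 0 by elim: (i) => //= k ->; rewrite raddf0.
  by rewrite linear0 !mulr0 linear0.
- by rewrite linearD mulrDr hu hv iter_tauD mulrDr linearD.
- exact: tw ha hu.
Qed.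

Lemma theta1 : theta 1 = 1.
Proof.
have [t' _ t'K] : bijective theta by case: twist.
by rewrite -[LHS]mulr1 -(t'K 1) (twist_mul _ (hcomp1 wt g)) mul1r t'K.
Qed.

Lemma theta_inj : injective theta.
Proof. by case: twist => /bij_inj. Qed.

Lemma theta_surj v : exists u, theta u = v.
Proof. by case: twist => [[t' _ t'K]] _ _; exists (t' v). Qed.

Variables (n : nat) (Z : 'I_n -> B) (rho : 'I_n -> K).
Hypothesis Z_homog : forall k, gr 2%N (Z k).
Hypothesis Z_central : forall k u, Z k * u = u * Z k.
Hypothesis Z_eigen : forall k, tau (tau (Z k)) = rho k *: Z k.
Hypothesis rho_neq0 : forall k, rho k != 0.
Hypothesis Z_free : forall p : {mpoly K[n]}, lext (mmap1 Z) p = 0 -> p = 0.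
Notation ev := (lext (mmap1 Z)).

Let ev_inj : injective ev.
Proof.
move=> p q e; apply/eqP; rewrite -subr_eq0; apply/eqP/Z_free.
by rewrite linearB /= e subrr.
Qed.

Lemma iter_even_eigen e r u : tau (tau u) = r *: u -> iter (e + e) tau u = r ^+ e *: u.
Proof.
move=> h; elim: e => [|e IH]; first by rewrite scale1r.
by rewrite addSn addnS /= IH !linearZ /= h scalerA exprSr.
Qed.

Let ev_mulX p k : ev (p * 'X_k) = ev p * Z k.
Proof.
rewrite {1}(mpolyE p) mulr_suml linear_sum mulr_suml; apply: eq_bigr => m _.
rewrite -scalerAl -mpolyXD linearZ /= lextX -scalerAl; congr (_ *: _).
by rewrite commr_mmap1_M ?mmap1U // => i u; rewrite /GRing.comm Z_central.
Qed.

(** This relation is multiplicative because the left factor has even degree, so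
    that only powers of [tau^2] act on the right one. *)
Let twisted_pair (u : A) (U : B) : Prop :=
  exists c r e, [/\ c != 0, r != 0, gr (e + e)%N U, u = c *: theta U &
                    tau (tau U) = r *: U].

Let twisted_pair1 : twisted_pair 1 1.
Proof.
exists 1, 1, 0%N; rewrite oner_eq0 !rmorph1 !scale1r theta1; split=> //.
exact: hcomp1.
Qed.

Let twisted_pairM u U v V :
  twisted_pair u U -> twisted_pair v V -> twisted_pair (u * v) (U * V).
Proof.
move=> [c [r [e [c0 r0 hU -> tU]]]] [c' [r' [e' [c'0 r'0 hV -> tV]]]].
exists (c * c' * r' ^+ e), (r * r'), (e + e')%N; split.
- by rewrite !mulf_neq0 // expf_neq0.
- by rewrite mulf_neq0.
- by rewrite addnACA; apply: hcompM.
- rewrite -scalerAl -scalerAr scalerA (twist_mul _ hU) (iter_even_eigen _ tV).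
  by rewrite -scalerAr linearZ scalerA.
- by rewrite !rmorphM /= tU tV -scalerAl -scalerAr scalerA.
Qed.

Let twisted_pair_mon m : twisted_pair (mmap1 (theta \o Z) m) (mmap1 Z m).
Proof.
rewrite /mmap1; elim/big_ind2: _ => // [u U v V|k _]; first exact: twisted_pairM.
elim: (m k) => [|j IH]; first by rewrite !expr0.
rewrite !exprS; apply: twisted_pairM IH.
exists 1, (rho k), 1%N; rewrite oner_eq0 scale1r; split=> //.
Qed.

Let ev_tau2 p : exists q, tau (tau (ev p)) = ev q.
Proof.
have ex m : exists r, tau (tau (mmap1 Z m)) = r *: mmap1 Z m.
  by have [c [r [e [_ _ _ _ h]]]] := twisted_pair_mon m; exists r.
have [r rE] := boolp.choice ex.
exists (lext (fun m => r m *: 'X_[m]) p).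
rewrite !(linear_lext tau) (linear_lext ev); apply: eq_lext => m.
by rewrite /= rE linearZ /= lextX.
Qed.

Lemma subalg_evP u : reflect (exists p, u = ev p) (u \in subalg_pred Z).
Proof.
apply: (iffP idP) => [|[p ->]]; last first.
  apply: rpred_sum => m _; apply: rpredZ; apply: rpred_prod => k _.
  exact/rpredX/gen_in_subalg.
move: u; apply: subalg_ind => [|_ _ [p ->] [q ->]|c _ [p ->]|k _ [p ->]].
- by exists 'X_[0]; rewrite lextX mmap11.
- by exists (p + q); rewrite linearD.
- by exists (c *: p); rewrite linearZ.
- by exists (p * 'X_k); rewrite ev_mulX Z_central.
Qed.

Lemma subalg_thetaP v :
  reflect (exists p, v = theta (ev p)) (v \in subalg_pred (theta \o Z)).
Proof.
apply: (iffP idP) => [|[p ->]]; last first.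
  rewrite linear_lext; apply: rpred_sum => m _; apply: rpredZ.
  have [c [r [e [c0 _ _ h _]]]] := twisted_pair_mon m.
  have -> : theta (mmap1 Z m) = c^-1 *: mmap1 (theta \o Z) m.
    by rewrite h scalerA mulVf // scale1r.
  apply: rpredZ; apply: rpred_prod => k _; exact/rpredX/gen_in_subalg.
move: v; apply: subalg_ind => [|_ _ [p ->] [q ->]|c _ [p ->]|k _ [p ->]].
- by exists 'X_[0]; rewrite lextX mmap11 theta1.
- by exists (p + q); rewrite !linearD.
- by exists (c *: p); rewrite !linearZ.
- have [q qE] := ev_tau2 p.
  by exists (q * 'X_k); rewrite ev_mulX /= (twist_mul _ (Z_homog k)) /= qE Z_central.
Qed.

Lemma subalg_theta u : (theta u \in subalg_pred (theta \o Z)) = (u \in subalg_pred Z).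
Proof.
apply/subalg_thetaP/subalg_evP => [[p /theta_inj ->]|[p ->]]; by exists p.
Qed.

(** The images of commuting eigenvectors of [tau^2] commute up to ratios of
    eigenvalues, and their ordered monomials are nonzero multiples of the images
    of the commutative ones. *)
Lemma skew_polynomial_twist (J : Type) (y : J -> A) (z : 'I_n -> subalg y) :
  (forall j, y j \in subalg_pred (theta \o Z)) ->
  (forall k, val (z k) = theta (Z k)) -> skew_polynomial z.
Proof.
move=> y_in zE.
apply: (@skew_polynomial_of_free _ _ (fun i j => rho j / rho i)).
- by move=> i j; rewrite mulf_neq0 ?invr_eq0.
- move=> i j; apply: val_inj; rewrite subalg_valZ !subalg_valM !zE.
  rewrite !(twist_mul _ (Z_homog _)) /= !Z_eigen -!scalerAr !linearZ /= scalerA.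
  by rewrite [rho i * _]mulrC divfK // Z_central.
- move=> u; have : val u \in subalg_pred (theta \o Z).
    apply: (subalg_sub (a := y)) (valP u) => j; exact: y_in.
  case/subalgP => p pE; exists p; apply: val_inj; rewrite pE /nceval subalg_val_sum.
  apply: eq_bigr => t _; rewrite subalg_valZ subalg_val_prod; congr (_ *: _).
  by apply: eq_bigr => k _; rewrite zE.
move=> p p0.
have ex m : exists c, c != 0 /\ mmap1 (theta \o Z) m = c *: theta (mmap1 Z m).
  by have [c [r [e [c0 _ _ h _]]]] := twisted_pair_mon m; exists c.
have [c hc] := boolp.choice ex.
have q0 : lext (fun m => c m *: 'X_[m]) p = 0 :> {mpoly K[n]}.
  apply/Z_free/theta_inj; rewrite linear0 -(subalg_val0 y) -p0 subalg_val_sum.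
  rewrite (linear_lext ev) linear_lext; apply: eq_bigr => m _.
  rewrite subalg_valZ; congr (_ *: _); rewrite linearZ /= lextX linearZ /= -(proj2 (hc m)).
  by rewrite /mmap1 subalg_val_prod; apply: eq_bigr => k _; rewrite subalg_valX zE.
apply/mpolyP => m; have /eqP := congr1 (mcoeff m) q0.
by rewrite mcoeff_lext_scale !mcoeff0 mulf_eq0 (negPf (proj1 (hc m))) => /eqP.
Qed.

(** Let [w] be the sum of [c i Z i], with [c i] and [c j] nonzero.  Comparing
    the coefficients of [Z i Z i], [Z j Z j] and [Z i Z j] in the equation that
    moves [theta (Z i)] past [theta w] gives [rho i = rho j]. *)
Lemma normal_eigen w : lspan Z w ->
  (forall k, exists2 f, f \in subalg_pred (theta \o Z) &
     theta w * theta (Z k) = f * theta w) ->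
  exists2 r, r != 0 & tau (tau w) = r *: w.
Proof.
move=> [c wE] hw.
have rho_eq i j : c i != 0 -> c j != 0 -> rho i = rho j.
  move=> ci cj; have [->//|nij] := eqVneq i j.
  have [_ /subalg_thetaP [p ->] e] := hw i.
  (* [theta (ev p)] times [theta (Z l)] is [theta (ev (q l) * Z l)]. *)
  pose q l : {mpoly K[n]} := lext (fun m => rho l ^+ mdeg m *: 'X_[m]) p.
  have qE l m : (q l)@_m = rho l ^+ mdeg m * p@_m by apply: mcoeff_lext_scale.
  have eq_poly : \sum_l (rho i * c l) *: 'X_[U_(l) + U_(i)] =
      \sum_l c l *: (q l * 'X_l) :> {mpoly K[n]}.
    apply/ev_inj/theta_inj; transitivity (theta w * theta (Z i)).
      have w2 : gr 2%N w by rewrite wE; apply: hcomp_sum => l _; apply: hcompZ.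
      rewrite (twist_mul _ w2) /= Z_eigen; apply: congr1.
      rewrite linear_sum wE mulr_suml; apply: eq_bigr => l _.
      rewrite linearZ /= lextX commr_mmap1_M ?mmap1U; last first.
        by move=> k u; rewrite /GRing.comm Z_central.
      by rewrite -scalerAl -scalerAr scalerA mulrC.
    transitivity (\sum_l c l *: (theta (ev p) * theta (Z l))).
      rewrite e wE [X in _ * X]linear_sum mulr_sumr; apply: eq_bigr => l _.
      by rewrite linearZ /= scalerAr.
    have -> : theta (ev (\sum_l c l *: (q l * 'X_l))) =
        \sum_l c l *: theta (ev (q l) * Z l).
      rewrite (linear_sum ev) (linear_sum theta); apply: eq_bigr => l _ /=.
      by rewrite linearZ /= linearZ /= ev_mulX.
    apply: eq_bigr => l _; congr (_ *: _).
    have -> : ev (q l) = lext (fun m => rho l ^+ mdeg m *: mmap1 Z m) p.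
      by rewrite linear_lext; apply: eq_lext => m; rewrite linearZ /= lextX.
    rewrite linear_lext mulr_suml mulr_suml linear_sum; apply: eq_bigr => m _.
    have hm : gr (mdeg m + mdeg m)%N (mmap1 Z m).
      rewrite /mmap1 mdegE; elim: (index_enum _) => [|k s IH].
        by rewrite !big_nil; apply: hcomp1.
      rewrite !big_cons addnACA; apply: hcompM IH.
      elim: (m k) => [|a IHa]; first exact: hcomp1.
      by rewrite exprS addSn addnS -[(a + a).+2]add2n; apply: hcompM.
    rewrite -!scalerAl (twist_mul _ hm) (iter_even_eigen _ (Z_eigen l)) linearZ /=.
    by rewrite -scalerAr.
  have coefX l (m : 'X_{1..n}) : (q l * 'X_l)@_m =
      if m l == 0%N then 0 else rho l ^+ mdeg (m - U_(l)) * p@_(m - U_(l)).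
    case: ifP => [/eqP ml|/negbT ml].
      apply: memN_msupp_eq0; rewrite (perm_mem (msuppMX _ _)); apply/mapP => [[k _ mE]].
      by move: ml; rewrite mE mnmDE mnm1E eqxx.
    by rewrite -{1}(@submK _ U_(l)%MM m) ?lep1mP // addmC mcoeffMX qE.
  have nji : j != i by rewrite eq_sym.
  have at_ m : \sum_l (rho i * c l) * (U_(l) + U_(i) == m)%MM%:R =
      \sum_l c l * (q l * 'X_l)@_m.
    have := congr1 (mcoeff m) eq_poly; rewrite !raddf_sum /=.
    under eq_bigr do rewrite mcoeffZ mcoeffX.
    by move=> ->; apply: eq_bigr => l _; rewrite mcoeffZ.
  have ij0 : (i == j) = false by apply/negbTE.
  have ji0 : (j == i) = false by apply/negbTE.
  have hjj : p@_U_(j) = 0.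
    have := at_ (U_(j) + U_(j))%MM; rewrite big1 => [|l _]; last first.
      case: eqP => [/mnmP/(_ i)|_]; rewrite ?mulr0 //.
      by rewrite !mnmDE !mnm1E eqxx ji0 addn1.
    rewrite (bigD1 j) //= big1 ?addr0 => [|l lj]; last first.
      by rewrite coefX mnmDE !mnm1E [j == l]eq_sym (negPf lj) mulr0.
    rewrite coefX mnmDE mnm1E eqxx addmK => /esym/eqP.
    by rewrite !mulf_eq0 (negPf cj) expf_eq0 (negPf (rho_neq0 j)) andbF => /eqP.
  have hii : p@_U_(i) = 1.
    have := at_ (U_(i) + U_(i))%MM; rewrite (bigD1 i) //= eqxx big1 ?addr0 => [|l li]; last first.
      by rewrite eqm_add2r eq_mnm1 (negPf li) mulr0.
    rewrite (bigD1 i) //= big1 ?addr0 => [|l li]; last first.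
      by rewrite coefX mnmDE !mnm1E [i == l]eq_sym (negPf li) mulr0.
    rewrite coefX mnmDE mnm1E eqxx addmK mdeg1 expr1 mulr1 => h.
    apply: (mulfI (mulf_neq0 ci (rho_neq0 i))); rewrite mulr1 -mulrA -h.
    by rewrite mulrC.
  have := at_ (U_(j) + U_(i))%MM; rewrite (bigD1 j) //= eqxx big1 ?addr0 => [|l lj]; last first.
    by rewrite eqm_add2r eq_mnm1 (negPf lj) mulr0.
  rewrite (bigD1 j) //= (bigD1 i) ?nij //= big1 ?addr0 => [|l /andP [lj li]]; last first.
    by rewrite coefX mnmDE !mnm1E [j == l]eq_sym [i == l]eq_sym (negPf li) (negPf lj) mulr0.
  rewrite !coefX !mnmDE !mnm1E !eqxx ij0 ji0 /= addmK [(U_(j) + U_(i))%MM]addmC addmK.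
  rewrite hjj hii mulr0 mulr0 addr0 !mulr1 mdeg1 expr1 => h.
  by apply: (mulfI cj); rewrite -h mulrC.
case: (boolP [exists i, c i != 0]) => [/existsP [i ci]|/existsPn c0]; last first.
  exists 1; rewrite ?oner_eq0 // wE big1 ?raddf0 ?scaler0 // => i _.
  by have /negPn/eqP -> := c0 i; rewrite scale0r.
exists (rho i) => //; rewrite wE (linear_sum tau) (linear_sum tau) scaler_sumr.
apply: eq_bigr => l _; rewrite /= linearZ /= linearZ /= Z_eigen !scalerA.
have [->|cl] := eqVneq (c l) 0.
  by rewrite mul0r mulr0.
by rewrite (rho_eq _ _ ci cl) mulrC.
Qed.

End TwistedMonomials.

(** * Bases, dimensions and bijections *)

(** The coordinates of the [e j] form a matrix of full row space, so [n] of its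
    rows form an invertible matrix. *)
Lemma basis_of_spanning (K : fieldType) (U : lmodType K) n m (b : 'I_n -> U)
    (e : 'I_m -> U) :
  (forall c, \sum_i c i *: b i = 0 -> forall i, c i = 0) ->
  (forall i, lspan e (b i)) -> (forall j, lspan b (e j)) ->
  exists f : 'I_n -> 'I_m, forall i, lspan (e \o f) (b i).
Proof.
move=> free be eb.
have /fin_all_exists [F FE] := be; have /fin_all_exists [G GE] := eb.
pose mF := \matrix_(i, j) F i j; pose mG := \matrix_(i, j) G i j.
have FG1 : mF *m mG = 1%:M.
  apply/matrixP => i k; rewrite !mxE; under eq_bigr do rewrite !mxE.
  apply/eqP; rewrite -subr_eq0; apply/eqP.
  apply: (free (fun k => \sum_j F i j * G j k - (i == k)%:R)).
  under eq_bigr do rewrite scalerBl scaler_suml.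
  rewrite sumrB exchange_big /= [X in _ - X](bigD1 i) //= eqxx scale1r.
  rewrite [X in _ - (_ + X)]big1 ?addr0; last first.
    by move=> l; rewrite eq_sym => /negPf ->; rewrite scale0r.
  apply/eqP; rewrite subr_eq0 [b i]FE; apply/eqP/eq_bigr => j _.
  by rewrite [e j]GE scaler_sumr; apply: eq_bigr => l _; rewrite scalerA.
have fullG : row_full mG by apply/row_fullP; exists mF.
pose f := fullrankfun fullG; have := fullrowsub_unit fullG.
rewrite -/f => unitG; exists f => i.
pose H := invmx (rowsub f mG); exists (fun j => H i j).
have /matrixP HG := mulVmx unitG; rewrite -/H in HG.
transitivity (\sum_k (\sum_j H i j * G (f j) k) *: b k).
  have HGE k : \sum_j H i j * G (f j) k = (i == k)%:R.
    have := HG i k; rewrite !mxE => <-.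
    by apply: eq_bigr => j _; rewrite !mxE.
  rewrite (bigD1 i) //= HGE eqxx scale1r big1 ?addr0 // => k ki.
  by rewrite HGE eq_sym (negPf ki) scale0r.
under eq_bigr do rewrite scaler_suml.
rewrite exchange_big; apply: eq_bigr => j _ /=.
by rewrite [e (f j)]GE scaler_sumr; apply: eq_bigr => k _; rewrite scalerA.
Qed.

Lemma has_dim_preim (K : fieldType) (U V : lmodType K) (f : {linear U -> V})
    (P : U -> Prop) (R : V -> Prop) d :
  bijective f -> (forall u, P u <-> R (f u)) -> has_dim *:%R R d -> has_dim *:%R P d.
Proof.
move=> [g gK fK] PR [b [Rb free span]]; exists (g \o b); split.
- by move=> i; apply/PR; rewrite /= fK.
- move=> c c0; apply: free; transitivity (f (\sum_i c i *: g (b i))).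
    by rewrite linear_sum; apply: eq_bigr => i _; rewrite linearZ /= fK.
  by rewrite c0 linear0.
- move=> u /PR/span [c cE]; exists c; apply: (can_inj gK); rewrite cE linear_sum.
  by apply: eq_bigr => i _; rewrite linearZ /= fK.
Qed.

Lemma inj_surj_bij (S T : Type) (f : S -> T) :
  injective f -> (forall v, exists u, f u = v) -> bijective f.
Proof.
move=> inj surj; have [g gK] := boolp.choice surj.
by exists g => // u; apply: inj.
Qed.

(** * Consequences of the Clifford relations *)

Section CliffordRelations.
Variables (K : fieldType) (n : nat) (A : algType K) (x y : 'I_n -> A).
Variables (mu : 'M[K]_n) (M : 'I_n -> 'M[K]_n).

Lemma clifford_relE i j : nceval (cgen x y) (clifford_rel mu M i j) =
  x i * x j + mu i j *: (x j * x i) - \sum_k M k i j *: y k.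
Proof.
rewrite /nceval /clifford_rel !big_cons !big_nil !mulr1 scale1r big_map.
rewrite big_enum /= -addrA; congr (_ + (_ + _)); rewrite -sumrN.
by apply: eq_bigr => k _; rewrite big_seq1 scaleNr.
Qed.

Lemma clifford_rel_homog i j : nchomog (@cwt n) 2 (clifford_rel mu M i j).
Proof.
rewrite /nchomog /clifford_rel /= !big_cons !big_nil /= all_map.
by apply/allP => k _ /=; rewrite big_seq1.
Qed.

Lemma cgrading1_lspan u : cgrading x y 1 u -> lspan x u.
Proof.
move: u; suff h d u : cgrading x y d u ->
    match d with 0%N => exists c, u = c%:A | 1%N => lspan x u | _ => True end.
  by move=> u; apply: h.
move: d u; apply: hcomp_min.
- by case=> [|[|d]] //; [exists 0; rewrite scale0r | apply: lspan0].
- case=> [|[|d]] u v //; last exact: lspanD.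
  by move=> [c ->] [c' ->]; exists (c + c'); rewrite scalerDl.
- case=> [|[|d]] c u //; last exact: lspanZ.
  by move=> [c' ->]; exists (c * c'); rewrite scalerA.
- by exists 1; rewrite scale1r.
- move=> [|d] [i|k] u //= [c ->]; rewrite -scalerAr mulr1; exact/lspanZ/lspan_gen.
Qed.

End CliffordRelations.

Lemma GCA_central (K : fieldType) (n : nat) (B : algType K) (N : 'I_n -> 'M[K]_n)
    (X Y : 'I_n -> B) :
  is_GCA N X Y -> forall k u, Y k * u = u * Y k.
Proof.
move=> [_ [gen rel0 _]] k u; have [p ->] := gen u.
apply: (@nceval_ind _ _ _ _ (fun u => Y k * u = u * Y k)).
- by rewrite mulr1 mul1r.
- by move=> v w hv hw; rewrite mulrDr mulrDl hv hw.
- by move=> c v hv; rewrite -scalerAr -scalerAl hv.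
move=> s v hv; have comm : Y k * cgen X Y s = cgen X Y s * Y k.
  apply/eqP; rewrite -subr_eq0.
  have <- : nceval (cgen X Y) [:: (1, [:: inr k; s]); (-1, [:: s; inr k])] =
      Y k * cgen X Y s - cgen X Y s * Y k.
    by rewrite /nceval !big_cons !big_nil !mulr1 scale1r addr0 scaleN1r.
  by apply/eqP/rel0; right; exists k, s.
by rewrite mulrA comm -mulrA hv mulrA.
Qed.

(** * The twist of a graded Clifford algebra *)

Section Main.
Variables (K : closedFieldType) (n : nat).
Variables (A : algType K) (mu : 'M[K]_n) (M : 'I_n -> 'M[K]_n) (x y : 'I_n -> A).
Variables (B : algType K) (N : 'I_n -> 'M[K]_n) (X Y : 'I_n -> B).
Variables (tau : {lrmorphism B -> B}) (theta : {linear B -> A}).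
Hypothesis char2 : 2%N \notin [pchar K].
Hypothesis gsca : is_GSCA mu M x y.
Hypothesis reg : regular n (cgrading x y).
Hypothesis gca : is_GCA N X Y.
Hypothesis aut : graded_aut (cgrading X Y) tau.
Hypothesis twist : twist_via (cgrading X Y) (cgrading x y) tau theta.
Hypothesis span_theta : forall u, lspan Y u <-> lspan y (theta u).

Notation grB := (cgrading X Y).
Notation grA := (cgrading x y).

Let two_neq0 : 2%:R != 0 :> K.
Proof. by apply: contra char2 => h; rewrite inE /= h. Qed.

Let B_gen u : exists p, u = nceval (cgen X Y) p.
Proof. by case: gca => _ []. Qed.

Let grB_indep : independent_grading grB.
Proof.
case: gca => _ pres; apply: (presented_independent pres) => p [[i [j ->]]|[k [s ->]]].
  by exists 2%N; apply: clifford_rel_homog.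
exists (2 + cwt s)%N; rewrite /nchomog /= !big_cons !big_nil /= !addn0 eqxx.
by rewrite addnC eqxx.
Qed.

Let grA_indep : independent_grading grA.
Proof.
case: gsca => _ _ [relb [hb pres _]]; apply: (presented_independent pres) => p.
case=> [[i [j ->]]|/hb [h|h]]; [|by exists 3%N|by exists 4%N].
by exists 2%N; apply: clifford_rel_homog.
Qed.

Let theta_bij : bijective theta. Proof. by case: twist. Qed.
Let grP d u : grB d u <-> grA d (theta u). Proof. by case: twist => _ h _; apply: h. Qed.
Let tau_gr d u : grB d u -> grB d (tau u). Proof. by case: aut => _; apply. Qed.
Let tau_bij : bijective tau. Proof. by case: aut. Qed.
Let tmul d a b : grB d a -> theta a * theta b = theta (a * iter d tau b).
Proof. exact: (twist_mul B_gen twist). Qed.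
Let tinj : injective theta. Proof. exact: bij_inj. Qed.

Let dimB d : has_dim *:%R (grB d) 'C((n + d).-1, d).
Proof.
case: reg => _ _ _ dimA; exact: (has_dim_preim theta_bij (grP d)) (dimA d).
Qed.

Let grX i : grB 1%N (X i). Proof. exact: (@hcomp_gen _ _ _ (@cwt n) (cgen X Y) (inl i)). Qed.
Let grY k : grB 2%N (Y k). Proof. exact: (@hcomp_gen _ _ _ (@cwt n) (cgen X Y) (inr k)). Qed.
Let grx i : grA 1%N (x i). Proof. exact: (@hcomp_gen _ _ _ (@cwt n) (cgen x y) (inl i)). Qed.

Let Y_central : forall k u, Y k * u = u * Y k. Proof. exact: GCA_central gca. Qed.

Let X_anticomm i j : lspan Y (X i * X j + X j * X i).
Proof.
case: gca => _ [_ rel0 _].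
have := rel0 (clifford_rel (const_mx 1) N i j); rewrite clifford_relE mxE scale1r.
by move=> h; exists (fun k => N k i j); apply/eqP; rewrite -subr_eq0; apply/eqP/h; left; exists i, j.
Qed.

Let anticomm1 u v : grB 1%N u -> grB 1%N v -> lspan Y (u * v + v * u).
Proof.
move=> /cgrading1_lspan [c ->] /cgrading1_lspan [c' ->].
have -> : (\sum_i c i *: X i) * (\sum_i c' i *: X i) + (\sum_i c' i *: X i) * (\sum_i c i *: X i) =
    \sum_i \sum_j (c i * c' j) *: (X i * X j + X j * X i).
  rewrite !mulr_suml; under [X in _ + X]eq_bigr do rewrite mulr_sumr.
  rewrite [X in _ + X]exchange_big -big_split; apply: eq_bigr => i _ /=.
  rewrite mulr_sumr -big_split; apply: eq_bigr => j _ /=.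
  by rewrite scalerDr -!scalerAl -!scalerAr !scalerA [c' j * _]mulrC.
by apply: lspan_sum => i _; apply: lspan_sum => j _; apply: lspanZ.
Qed.

Let pre_x : exists a : 'I_n -> B, forall i, theta (a i) = x i.
Proof. by have [g _ gK] := theta_bij; exists (g \o x) => i; apply: gK. Qed.

Section Eigen.
Variable a : 'I_n -> B.
Hypothesis aE : forall i, theta (a i) = x i.

Let gra i : grB 1%N (a i). Proof. by apply/grP; rewrite aE. Qed.

Let lspan_a u : grB 1%N u -> lspan a u.
Proof.
move=> /grP/cgrading1_lspan [c cE]; exists c; apply: tinj; rewrite cE linear_sum.
by apply: eq_bigr => i _; rewrite linearZ /= aE.
Qed.

(** The systems [a, Z] and [X, Y] span the same spaces in degrees one and two, so
    they define the same grading and the dimension count applies to both. *)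
Let mon_free (Z : 'I_n -> B) : (forall u, lspan Z u <-> lspan Y u) ->
  forall p : {mpoly K[n]}, lext (clifford_mon a Z) p = 0 -> p = 0.
Proof.
move=> ZY; have grE d u : hcomp (@cwt n) (cgen a Z) d u <-> grB d u.
  split; apply: hcomp_sub => [[i|k]] /=.
  - exact: gra.
  - by apply: (hcomp_lspan grY); apply/ZY/lspan_gen.
  - apply: hcomp_lspan (lspan_a (grX i)) => j.
    exact: (@hcomp_gen _ _ _ (@cwt n) (cgen a Z) (inl j)).
  - have /ZY : lspan Y (Y k) by apply: lspan_gen.
    by apply: hcomp_lspan => j; exact: (@hcomp_gen _ _ _ (@cwt n) (cgen a Z) (inr j)).
apply: clifford_mon_free => //.
- move=> k u; have /ZY [c ->] : lspan Z (Z k) by apply: lspan_gen.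
  rewrite mulr_suml mulr_sumr; apply: eq_bigr => j _.
  by rewrite -scalerAl -scalerAr Y_central.
- by move=> i j; apply/ZY/anticomm1.
- move=> d; have [b [bP bf bs]] := dimB d; exists b; split=> // [i|u /grE/bs //].
  exact/grE.
- by move=> T s dg u h; apply: grB_indep => t; apply/grE.
Qed.

Let Y_refl u : lspan Y u <-> lspan Y u. Proof. by []. Qed.

Let sym_coef (c : 'I_n -> 'I_n -> K) :
  lspan Y (\sum_i \sum_j c i j *: (a i * a j)) -> forall i j, c i j = c j i.
Proof.
apply: symmetric_coefficients => //; last exact: mon_free.
by move=> i j; apply: anticomm1.
Qed.

(** Since [mu i i = 1], the relation for [x i x i] puts [a i (tau (a i))] in
    the span of the [Y k]; modulo that span the degree-one part of [B] generates
    an exterior algebra, so [tau (a i)] is proportional to [a i]. *)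
Let a_eigen i : exists r, tau (a i) = r *: a i.
Proof.
have sq : lspan Y (a i * tau (a i)).
  apply/span_theta; rewrite -[tau _]/(iter 1 tau (a i)) -(tmul _ (gra i)) !aE.
  case: gsca => [[_ mu1] _ [relb [_ [_ rel0 _] _]]].
  have := rel0 (clifford_rel mu M i i); rewrite clifford_relE mu1 scale1r => h.
  have -> : x i * x i = 2%:R^-1 *: (x i * x i + x i * x i).
    by rewrite -mulr2n -scaler_nat scalerA mulVf // scale1r.
  apply: lspanZ; exists (fun k => M k i i).
  by apply/eqP; rewrite -subr_eq0; apply/eqP/h; left; exists i, i.
have [b bE] := lspan_a (tau_gr (gra i)).
exists (b i); rewrite bE (bigD1 i) //= big1 ?addr0 // => j ji.
have := @sym_coef (fun p q => (p == i)%:R * b q) _ i j; rewrite eqxx (negPf ji) mul1r mul0r.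
move=> -> //; first by rewrite scale0r.
rewrite (bigD1 i) //= [X in _ + X]big1 ?addr0 => [|p /negPf pi]; last first.
  by apply: big1 => q _; rewrite pi mul0r scale0r.
rewrite bE mulr_sumr in sq; move: sq.
rewrite (_ : \sum_(i0 < n) _ = \sum_j0 (true%:R * b j0) *: (a i * a j0)) ?eqxx //.
by apply: eq_bigr => q _; rewrite mul1r scalerAr.
Qed.

Notation pairs := #|{: 'I_n * 'I_n}|.
Let prod2 (t : 'I_pairs) : B := a (enum_val t).1 * a (enum_val t).2.
Let anti2 (t : 'I_pairs) : B :=
  a (enum_val t).1 * a (enum_val t).2 + a (enum_val t).2 * a (enum_val t).1.

Let lspan_prod2 u v : grB 1%N u -> grB 1%N v -> lspan prod2 (u * v).
Proof.
move=> /lspan_a [c ->] /lspan_a [c' ->]; rewrite mulr_suml.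
apply: lspan_sum => i _; rewrite mulr_sumr; apply: lspan_sum => j _.
rewrite -scalerAl -scalerAr; do 2 apply: lspanZ.
by have := lspan_gen prod2 (enum_rank (i, j)); rewrite /prod2 enum_rankK.
Qed.

(** [A] is generated by its degree-one part.  The terms of degree two of an
    expression of [theta (Y k)] as a polynomial in such generators already give
    it, by independence of the grading, and a product
    [theta (b) theta (b')] with [b] of degree one is [theta (b (tau b'))]. *)
Let Y_prod2 k : lspan prod2 (Y k).
Proof.
case: reg => [[m [v [rel [v1 relh [vgen _ _]]]]] _ _ _].
have key u : grA 2%N u -> exists2 w, lspan prod2 w & theta w = u.
  move=> u2; have [p pE] := vgen u.
  have word w : grA (size w) (\prod_(i <- w) v i).
    elim: w => [|i w IH]; rewrite ?big_nil ?big_cons; first exact: hcomp1.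
    exact: (hcompM (v1 i) IH).
  (* The extra entry [None] carries [- u], in degree two. *)
  pose F (o : option (K * seq 'I_m)) : A :=
    if o is Some t then t.1 *: \prod_(i <- t.2) v i else - u.
  pose dg (o : option (K * seq 'I_m)) : nat := if o is Some t then size t.2 else 2%N.
  have := grA_indep (s := None :: [seq Some t | t <- p]) (dg := dg) (u := F).
  move=> /(_ _ _ 2%N); rewrite !big_cons /= !big_map => h.
  have {h} h : - u + \sum_(t <- p | size t.2 == 2%N) t.1 *: \prod_(i <- t.2) v i = 0.
    apply: h; last by rewrite /F /= pE /nceval addNr.
    case=> [t|] /=; first exact/hcompZ/word.
    by rewrite -scaleN1r; apply: hcompZ.
  have [g gK Kg] := theta_bij.
  exists (g u); last exact: Kg.
  have -> : u = \sum_(t <- p | size t.2 == 2%N) t.1 *: \prod_(i <- t.2) v i.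
    by apply/eqP; rewrite -subr_eq0 -oppr_eq0 opprB addrC h.
  have -> : g (\sum_(t <- p | size t.2 == 2%N) t.1 *: \prod_(i <- t.2) v i) =
      \sum_(t <- p | size t.2 == 2%N) t.1 *: g (\prod_(i <- t.2) v i).
    apply: tinj; rewrite Kg linear_sum; apply: eq_bigr => t _.
    by rewrite linearZ /= Kg.
  apply: lspan_sum => -[c [|i [|j [|]]]] //= _; apply: lspanZ.
  rewrite !big_cons big_nil mulr1 -(Kg (v i)) -(Kg (v j)).
  have gr1 l : grB 1%N (g (v l)) by apply/grP; rewrite Kg; apply: v1.
  by rewrite (tmul _ (gr1 i)) gK; apply: lspan_prod2 => //; apply: tau_gr.
by have [|w hw /tinj <-] := key (theta (Y k)); first exact/grP.
Qed.

(** The coefficients of an expression of [Y k] in the [a i a j] are symmetric, so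
    it equals half of the same combination of the anticommutators. *)
Let Y_anti2 k : lspan anti2 (Y k).
Proof.
have [c cE] := Y_prod2 k; pose c2 i j := c (enum_rank (i, j)).
have sumE (F : 'I_n -> 'I_n -> B) :
    \sum_(t < pairs) F (enum_val t).1 (enum_val t).2 = \sum_i \sum_j F i j.
  by rewrite pair_big /= -(big_enum_val (fun p => F p.1 p.2)); apply: eq_bigl.
have YE : Y k = \sum_i \sum_j c2 i j *: (a i * a j).
  rewrite cE -(sumE (fun i j => c2 i j *: (a i * a j))); apply: eq_bigr => t _.
  by rewrite /c2 -surjective_pairing enum_valK.
have c2C : forall i j, c2 i j = c2 j i by apply: sym_coef; rewrite -YE; apply: lspan_gen.
exists (fun t => 2%:R^-1 * c t); apply: (scalerI two_neq0).
rewrite scaler_sumr scaler_nat mulr2n {1}YE [in RHS](eq_bigr (fun t => c t *: prod2 t +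
  c2 (enum_val t).1 (enum_val t).2 *: (a (enum_val t).2 * a (enum_val t).1))); last first.
  move=> t _; rewrite scalerA mulrA mulfV // mul1r scalerDr; congr (_ + _ *: _).
  by rewrite /c2 -surjective_pairing enum_valK.
rewrite big_split /= -cE -YE; congr (_ + _).
rewrite (sumE (fun i j => c2 i j *: (a j * a i))) exchange_big YE.
by apply: eq_bigr => i _; apply: eq_bigr => j _; rewrite c2C.
Qed.

Lemma subspan_mmap_free (Z : 'I_n -> B) : (forall u, lspan Z u <-> lspan Y u) ->
  forall p : {mpoly K[n]}, lext (mmap1 Z) p = 0 -> p = 0.
Proof. by move=> ZY p; apply: free_even; apply: mon_free. Qed.

(** The anticommutators of the eigenvectors [a i] span the [Y k], so a basis of
    that span can be chosen among them. *)
Lemma tau_eigenbasis : exists (Z : 'I_n -> B) (zeta : 'I_n -> K),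
  [/\ forall u, lspan Z u <-> lspan Y u, forall k, tau (Z k) = zeta k *: Z k &
      forall k, zeta k != 0].
Proof.
have [lam lamE] := fin_all_exists a_eigen.
have anti_Y t : lspan Y (anti2 t) by apply: anticomm1.
have Y_free := free_generators (mon_free Y_refl).
have [f fE] := basis_of_spanning Y_free Y_anti2 anti_Y.
pose Z := anti2 \o f; pose zeta k := lam (enum_val (f k)).1 * lam (enum_val (f k)).2.
have ZY u : lspan Z u <-> lspan Y u.
  by split; apply: lspan_trans => // k; apply: anti_Y.
have Z_eig k : tau (Z k) = zeta k *: Z k.
  rewrite /Z /= /anti2 rmorphD !rmorphM /= !lamE -!scalerAl -!scalerAr !scalerA.
  by rewrite scalerDr [_ * lam (enum_val (f k)).1]mulrC.
exists Z, zeta; split=> // k; apply/eqP => z0.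
have Zk0 : Z k = 0 by apply: (bij_inj tau_bij); rewrite Z_eig z0 scale0r raddf0.
have := free_generators (mon_free ZY) (c := fun i => (i == k)%:R) _ k.
rewrite eqxx => /(_ _)/eqP; rewrite oner_eq0 => h; apply/notF/h.
by rewrite (bigD1 k) //= Zk0 scaler0 add0r big1 // => i /negPf ->; rewrite scale0r.
Qed.

End Eigen.

Let mmap_free (Z : 'I_n -> B) : (forall u, lspan Z u <-> lspan Y u) ->
  forall p : {mpoly K[n]}, lext (mmap1 Z) p = 0 -> p = 0.
Proof. by move=> ZY p; have [a aE] := pre_x; apply: (subspan_mmap_free aE ZY). Qed.

Let spanY_homog u : lspan Y u -> hcomp (@cwt n) (cgen X Y) 2 u.
Proof. exact: hcomp_lspan. Qed.

Let spanY_central u v : lspan Y u -> u * v = v * u.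
Proof.
move=> [c ->]; rewrite mulr_suml mulr_sumr; apply: eq_bigr => j _.
by rewrite -scalerAl -scalerAr Y_central.
Qed.

Let spanning_in (Z : 'I_n -> B) : (forall u, lspan Z u <-> lspan Y u) ->
  forall k, lspan Y (Z k).
Proof. by move=> ZY k; apply/ZY/lspan_gen. Qed.

Section Basis.
Variable Z : 'I_n -> B.
Hypothesis ZY : forall u, lspan Z u <-> lspan Y u.

Let Z_homog k := spanY_homog (spanning_in ZY k).
Let Z_central k u := spanY_central u (spanning_in ZY k).

Lemma lspan_theta u : lspan (theta \o Z) (theta u) <-> lspan y (theta u).
Proof.
rewrite -span_theta -ZY; split=> -[c cE]; exists c.
  apply: tinj; rewrite cE linear_sum; apply: eq_bigr => i _; by rewrite linearZ.
by rewrite cE linear_sum; apply: eq_bigr => i _; rewrite linearZ.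
Qed.

Lemma subalg_Y u : (u \in subalg_pred Y) = (u \in subalg_pred Z).
Proof.
by apply/idP/idP; apply: subalg_sub => k; apply: lspan_in_subalg (gen_in_subalg _) _;
  apply/ZY/lspan_gen.
Qed.

Lemma subalg_y v : (v \in subalg_pred y) = (v \in subalg_pred (theta \o Z)).
Proof.
have [g gK Kg] := theta_bij.
apply/idP/idP; apply: subalg_sub => k; apply: lspan_in_subalg (gen_in_subalg _) _.
  by rewrite -(Kg (y k)); apply/lspan_theta; rewrite Kg; apply: lspan_gen.
by apply/lspan_theta/lspan_gen.
Qed.

Lemma skew_polynomial_of_eigen (rho : 'I_n -> K) (z : 'I_n -> subalg y) :
  (forall k, tau (tau (Z k)) = rho k *: Z k) -> (forall k, rho k != 0) ->
  (forall k, val (z k) = theta (Z k)) -> skew_polynomial z.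
Proof.
move=> Z_eig rho0 zE.
apply: (skew_polynomial_twist B_gen twist Z_homog Z_central Z_eig rho0 (mmap_free ZY)) => // j.
by rewrite -subalg_y gen_in_subalg.
Qed.

End Basis.

Lemma eigenbasis : exists (Z : 'I_n -> B) (zeta : 'I_n -> K),
  [/\ forall u, lspan Z u <-> lspan Y u, forall k, tau (Z k) = zeta k *: Z k &
      forall k, zeta k != 0].
Proof. by have [a aE] := pre_x; apply: tau_eigenbasis aE. Qed.

Section Restriction.
Variables (Z : 'I_n -> B) (zeta : 'I_n -> K).
Hypothesis ZY : forall u, lspan Z u <-> lspan Y u.
Hypothesis Z_eig : forall k, tau (Z k) = zeta k *: Z k.
Hypothesis zeta_neq0 : forall k, zeta k != 0.

Let Z_homog k := spanY_homog (spanning_in ZY k).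
Let Z_central k u := spanY_central u (spanning_in ZY k).

Let Z_eig2 k : tau (tau (Z k)) = zeta k ^+ 2 *: Z k.
Proof. by rewrite Z_eig linearZ /= Z_eig scalerA. Qed.

Let zeta2_neq0 k : zeta k ^+ 2 != 0.
Proof. exact: expf_neq0. Qed.

Let tau_subalg u : u \in subalg_pred Y -> tau u \in subalg_pred Y.
Proof.
rewrite !(subalg_Y ZY) => /subalgP [p ->]; rewrite rmorph_nceval.
apply: (subalg_sub (a := tau \o Z)) (nceval_in_subalg _ _) => k.
by rewrite /= Z_eig rpredZ ?gen_in_subalg.
Qed.

Let tau_subalg_surj v : v \in subalg_pred Y -> exists2 u, u \in subalg_pred Y & tau u = v.
Proof.
rewrite (subalg_Y ZY) => /subalgP [p ->].
exists (nceval (fun k => (zeta k)^-1 *: Z k) p).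
  rewrite (subalg_Y ZY).
  apply: (subalg_sub (a := fun k => (zeta k)^-1 *: Z k)) (nceval_in_subalg _ _) => k.
  by rewrite rpredZ ?gen_in_subalg.
rewrite rmorph_nceval; apply: eq_bigr => t _; congr (_ *: _); apply: eq_bigr => k _ /=.
by rewrite linearZ /= Z_eig scalerA mulVf // scale1r.
Qed.

Let theta_subalg u : (theta u \in subalg_pred y) = (u \in subalg_pred Y).
Proof.
rewrite (subalg_y ZY) (subalg_Y ZY).
exact: (subalg_theta B_gen twist Z_homog Z_central Z_eig2 zeta2_neq0).
Qed.

(** Both [tau] and [theta] restrict to the subalgebras, since they send the
    generators [Z k] to scalar multiples of the [Z k] and to generators. *)
Lemma subalg_twist :
  is_twist (sub_grading grB : nat -> subalg Y -> Prop)
           (sub_grading grA : nat -> subalg y -> Prop).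
Proof.
pose phi0 (u : subalg Y) : subalg Y := Subalg (tau_subalg (valP u)).
have theta_in (u : subalg Y) : theta (val u) \in subalg_pred y.
  by rewrite theta_subalg (valP u).
pose th0 (u : subalg Y) : subalg y := Subalg (theta_in u).
have phiE u : val (phi0 u) = tau (val u) by [].
have thE u : val (th0 u) = theta (val u) by [].
have phi_lin : linear phi0.
  move=> c u v; apply: val_inj.
  by rewrite phiE !subalg_valD !subalg_valZ !phiE linearP.
have phi_mul : monoid_morphism phi0.
  split=> [|u v]; apply: val_inj; rewrite phiE ?subalg_val1 ?rmorph1 //.
  by rewrite !subalg_valM !phiE rmorphM.
have th_lin : linear th0.
  move=> c u v; apply: val_inj.
  by rewrite thE !subalg_valD !subalg_valZ !thE linearP.
pose phi : {lrmorphism subalg Y -> subalg Y} := HB.pack phi0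
  (GRing.isLinear.Build K (subalg Y) (subalg Y) _ phi0 phi_lin)
  (GRing.isMonoidMorphism.Build (subalg Y) (subalg Y) phi0 phi_mul).
pose th : {linear subalg Y -> subalg y} := HB.pack th0
  (GRing.isLinear.Build K (subalg Y) (subalg y) _ th0 th_lin).
exists phi, th; split; split.
- apply: inj_surj_bij => [u v /(congr1 val)|v]; first by move/(bij_inj tau_bij)/val_inj.
  have [u uY uE] := tau_subalg_surj (valP v).
  by exists (Subalg uY); apply: val_inj; rewrite -[LHS]/(tau u) uE.
- by move=> d u; apply: tau_gr.
- apply: inj_surj_bij => [u v /(congr1 val)|v]; first by move/tinj/val_inj.
  have [u uE] := theta_surj twist (val v).
  have uY : u \in subalg_pred Y by rewrite -theta_subalg uE (valP v).
  by exists (Subalg uY); apply: val_inj; rewrite -[LHS]/(theta u) uE.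
- by move=> d u; apply: grP.
- move=> i j u v hu _; apply: val_inj.
  have iterE k : val (iter k phi v) = iter k tau (val v).
    by elim: k => //= k <-.
  by rewrite -[val (th _)]/(theta (val _)) !subalg_valM iterE -(tmul _ hu).
Qed.

(** For [u] of degree [d], [theta (u) theta (Z k)] is [zeta k ^+ d] times
    [theta (Z k u)], while [theta (Z k) theta (u)] is [theta (Z k (tau^2 u))];
    so the two sides differ by an invertible change of [u] preserving degrees. *)
Lemma theta_normal k : normal_elt (theta (Z k)).
Proof.
have theta_ind (P : A -> Prop) : P 0 -> (forall u v, P u -> P v -> P (u + v)) ->
    (forall d u, grB d u -> P (theta u)) -> forall e, P e.
  move=> P0 PD Ph e; have [u <-] := theta_surj twist e.
  move: u; apply: (homog_ind (wt := @cwt n) B_gen) => //.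
    by rewrite linear0.
  by move=> u v; rewrite linearD; apply: PD.
have iter_eig d : iter d tau (Z k) = zeta k ^+ d *: Z k.
  elim: d => [|d IH]; first by rewrite scale1r.
  by rewrite /= IH linearZ /= Z_eig scalerA -exprSr.
have right_mul d u : grB d u -> theta u * theta (Z k) = zeta k ^+ d *: theta (Z k * u).
  by move=> hu; rewrite (tmul _ hu) iter_eig -scalerAr linearZ Z_central.
have left_mul u : theta (Z k) * theta u = theta (Z k * tau (tau u)).
  exact: (tmul _ (Z_homog k)).
split; apply: theta_ind.
- by exists 0; rewrite mulr0 mul0r.
- by move=> u v [f fE] [g gE]; exists (f + g); rewrite mulrDr mulrDl fE gE.
- move=> d u hu; exists (theta ((zeta k ^+ d)^-1 *: tau (tau u))).
  rewrite left_mul (right_mul d); last by apply/hcompZ/tau_gr/tau_gr.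
  by rewrite -scalerAr linearZ scalerA mulfV ?expf_neq0 // scale1r.
- by exists 0; rewrite mulr0 mul0r.
- by move=> u v [f fE] [g gE]; exists (f + g); rewrite mulrDr mulrDl fE gE.
- move=> d u hu; have [t _ tK] := tau_bij.
  exists (theta (zeta k ^+ d *: t (t u))).
  by rewrite (right_mul d) // left_mul !linearZ /= !tK -scalerAr linearZ.
Qed.

Lemma skew_basis : exists z : 'I_n -> subalg y,
  [/\ forall u, lspan (fun k => val (z k)) u <-> lspan y u,
      normalizing_seq (fun k => val (z k)) & skew_polynomial z].
Proof.
have in_y k : theta (Z k) \in subalg_pred y.
  by rewrite (subalg_y ZY); apply: (gen_in_subalg (theta \o Z)).
pose z k : subalg y := Subalg (in_y k); exists z; split.
- move=> v; have [u <-] := theta_surj twist v; exact: lspan_theta.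
- have ideal0 (S : A -> Prop) : two_sided_ideal S 0.
    exists 0%N, (fun=> 0), (fun=> 0), (fun=> 0); split; first by case.
    by rewrite big_ord0.
  move=> k; have [hl hr] := theta_normal k; split=> e.
    by have [f fE] := hl e; exists f; rewrite /= fE subrr.
  by have [f fE] := hr e; exists f; rewrite /= fE subrr.
- exact: (skew_polynomial_of_eigen ZY Z_eig2 zeta2_neq0).
Qed.

(** A normal basis consists of images of eigenvectors of [tau^2], possibly
    different from those of [Z] when [tau^2] has a multiple eigenvalue. *)
Lemma skew_of_normal (z : 'I_n -> subalg y) :
  (forall u, lspan (fun k => val (z k)) u <-> lspan y u) ->
  (forall k, normal_elt (z k)) -> skew_polynomial z.
Proof.
move=> zy z_normal; have [g gK Kg] := theta_bij.
pose W k := g (val (z k)).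
have WE k : theta (W k) = val (z k) by apply: Kg.
have WY u : lspan W u <-> lspan Y u.
  rewrite span_theta -zy; split=> -[c cE]; exists c.
    by rewrite cE linear_sum; apply: eq_bigr => k _; rewrite linearZ /= WE.
  by apply: tinj; rewrite cE linear_sum; apply: eq_bigr => k _; rewrite linearZ /= WE.
have W_eig k : exists2 r, r != 0 & tau (tau (W k)) = r *: W k.
  apply: (normal_eigen B_gen twist Z_homog Z_central Z_eig2 zeta2_neq0 (mmap_free ZY)).
    by apply/ZY/WY/lspan_gen.
  move=> l; have in_y : theta (Z l) \in subalg_pred y.
    by rewrite (subalg_y ZY); apply: (gen_in_subalg (theta \o Z)).
  have [f /(congr1 val)] := (z_normal k).1 (Subalg in_y).
  rewrite !subalg_valM -WE => fE; exists (val f) => //.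
  by rewrite -(subalg_y ZY) (valP f).
have [r r0 rE] := fin_all_exists2 W_eig.
by apply: (skew_polynomial_of_eigen WY rE r0) => k; rewrite WE.
Qed.

End Restriction.
End Main.

Theorem theorem2p4 (K : closedFieldType) (n : nat)
    (A : algType K) (mu : 'M[K]_n) (M : 'I_n -> 'M[K]_n) (x y : 'I_n -> A)
    (B : algType K) (N : 'I_n -> 'M[K]_n) (X Y : 'I_n -> B)
    (tau : {lrmorphism B -> B}) (theta : {linear B -> A}) :
  2%N \notin [pchar K] ->
  is_GSCA mu M x y ->
  regular n (cgrading x y) ->
  is_GCA N X Y ->
  graded_aut (cgrading X Y) tau ->
  twist_via (cgrading X Y) (cgrading x y) tau theta ->
  (forall u, lspan Y u <-> lspan y (theta u)) ->
  let gradR : nat -> subalg y -> Prop := sub_grading (cgrading x y) in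
  let gradC : nat -> subalg Y -> Prop := sub_grading (cgrading X Y) in
  let spans_y (z : 'I_n -> subalg y) :=
    forall u, lspan (fun k => val (z k)) u <-> lspan y u in
  [/\ is_twist gradC gradR,
      exists z : 'I_n -> subalg y,
        [/\ spans_y z, normalizing_seq (fun k => val (z k))
          & skew_polynomial z]
    & forall z : 'I_n -> subalg y,
        spans_y z -> (forall k, normal_elt (z k)) -> skew_polynomial z].
Proof.
move=> char2 gsca reg gca aut twist span_theta gradR gradC spans_y.
have [Z [zeta [ZY Z_eig zeta_neq0]]] := eigenbasis char2 gsca reg gca aut twist span_theta.
split.
- exact: (subalg_twist gca aut twist span_theta ZY Z_eig zeta_neq0).
- exact: (skew_basis char2 reg gca aut twist span_theta ZY Z_eig zeta_neq0).
- exact: (skew_of_normal char2 reg gca twist span_theta ZY Z_eig zeta_neq0).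
Qed.
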